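(* Fix positive integers $a_1,a_2,a_3,a_4$. Let $S(n)$ be the maximum size of a Sidon subset $A\subseteq\{1,\dots,n\}$ such that there are no pairwise distinct $x_1,\dots,x_5\in A$ with $a_1x_1+a_2x_2+a_3x_3+a_4x_4=(a_1+a_2+a_3+a_4)x_5$. Then $S(n)=o(\sqrt n)$ and $S(n)\ge n^{1/2-o(1)}$; that is, $S(n)/\sqrt n\to 0$, and for every $\varepsilon>0$ we have $S(n)\ge n^{1/2-\varepsilon}$ for all sufficiently large $n$.
   Context: A set $A$ of integers is a Sidon set if it has no nontrivial solution to $x_1+x_2=x_3+x_4$ with $x_i\in A$, where a solution is trivial if $(x_1,x_2)=(x_3,x_4)$ or $(x_1,x_2)=(x_4,x_3)$. *)

(* Defs.v *)
From Stdlib Require Import Reals Lra Lia List Arith.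
Import ListNotations.
Open Scope R_scope.

(* A finite set of integers is represented by a duplicate-free list of naturals. *)

Definition Sidon (A : list nat) : Prop :=
  forall x1 x2 x3 x4, In x1 A -> In x2 A -> In x3 A -> In x4 A ->
    (x1 + x2 = x3 + x4)%nat ->
    (x1 = x3 /\ x2 = x4) \/ (x1 = x4 /\ x2 = x3).

Definition avoids_eq (a1 a2 a3 a4 : nat) (A : list nat) : Prop :=
  forall x1 x2 x3 x4 x5, In x1 A -> In x2 A -> In x3 A -> In x4 A -> In x5 A ->
    NoDup [x1; x2; x3; x4; x5] ->
    (a1 * x1 + a2 * x2 + a3 * x3 + a4 * x4 <> (a1 + a2 + a3 + a4) * x5)%nat.

Definition admissible (a1 a2 a3 a4 n : nat) (A : list nat) : Prop :=
  NoDup A /\ (forall x, In x A -> (1 <= x <= n)%nat) /\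
  Sidon A /\ avoids_eq a1 a2 a3 a4 A.

Definition is_max_size (a1 a2 a3 a4 n s : nat) : Prop :=
  (exists A, admissible a1 a2 a3 a4 n A /\ length A = s) /\
  (forall A, admissible a1 a2 a3 a4 n A -> (length A <= s)%nat).

(* Main.v *)
(** Upper bound.  Embed a Sidon set [A] of size at least [delta * sqrt n] into
    [G = Z/N], where [N] is of order [n] and coprime to all the coefficients
    that occur, and let [f] be its indicator function, normalised to mean 1.
    The Sidon property says that the autocorrelation of [f] is bounded away from
    0, so [f] behaves like a dense function: pairwise convolutions of [f] are
    bounded in L^2, and the number of solutions of a five-variable equation
    changes little when [f] is replaced by a function close to it in the norm of
    convolution operators on L^2.  A Croot-Sisask sampling argument gives a
    dense set of almost periods of [f] in that norm.  Averaging [f] over them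
    yields smoothings [g] that are bounded in L^2; by an energy increment, two
    smoothings at very different scales are close in L^2, and then the almost
    periods of the coarser one produce a positive proportion of all the
    solutions.  Solutions with two equal variables are fewer by a factor [1/|A|],
    so some solution in [A] has distinct variables.

    Lower bound.  For a fixed large prime [p], the points [(x, x^2)] of
    [F_(p^d)^2] form a Sidon set.  Write their coordinates over [F_p] as digits
    in base [p * (a1 + a2 + a3 + a4)], so that no carries occur, and keep only
    those [x] whose digit vector lies on a common sphere: a convex combination
    of points of a sphere is on that sphere only if the points coincide. *)

Require Import Defs.
From Stdlib Require Import Reals Lra Lia List Arith.
From Coquelicot Require Import Coquelicot.
From mathcomp Require all_boot all_order all_algebra all_field ring lra zify.
From mathcomp Require Rstruct.
Open Scope R_scope.

(* The MathComp notations are confined to a module because they would change the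
   meaning of [<=] on [nat] in the theorem. *)
Module Combinatorics.
Import all_boot all_order all_algebra all_field ring lra zify Rstruct.
Set Implicit Arguments. Unset Strict Implicit. Unset Printing Implicit Defensive.
Import Order.TTheory GRing.Theory Num.Theory.
Local Open Scope ring_scope.

(** * Averages over a finite abelian group *)

Definition avg (R : realFieldType) (G : finZmodType) (f : G -> R) : R :=
  #|G|%:R^-1 * \sum_x f x.

Notation "\avg_ i F" := (avg (fun i => F))
  (at level 34, F at level 34, i name, right associativity).

Section Averages.
Variables (R : realFieldType) (G : finZmodType).
Implicit Types f g h u v q : G -> R.

Lemma card_gt0R : 0 < #|G|%:R :> R.
Proof. by rewrite ltr0n; apply/card_gt0P; exists 0. Qed.

Lemma eq_avg f g : f =1 g -> avg f = avg g.
Proof. by move=> fg; congr (_ * _); apply: eq_bigr => x _. Qed.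

Lemma avgD f g : \avg_x (f x + g x) = avg f + avg g.
Proof. by rewrite /avg big_split mulrDr. Qed.

Lemma avgZ c f : \avg_x (c * f x) = c * avg f.
Proof. by rewrite /avg -mulr_sumr mulrCA. Qed.

Lemma avgZr c f : \avg_x (f x * c) = avg f * c.
Proof. by rewrite mulrC -avgZ; apply: eq_avg => x; rewrite mulrC. Qed.

Lemma avgN f : \avg_x (- f x) = - avg f.
Proof. by rewrite -mulN1r -avgZ; apply: eq_avg => x; rewrite mulN1r. Qed.

Lemma avgB f g : \avg_x (f x - g x) = avg f - avg g.
Proof. by rewrite avgD avgN. Qed.

Lemma avg_cst (c : R) : avg (fun _ : G => c) = c.
Proof.
rewrite /avg sumr_const -[c *+ _]mulr_natr mulrCA mulVf ?mulr1 //.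
by rewrite gt_eqF // card_gt0R.
Qed.

Lemma exchange_avg (F : G -> G -> R) :
  \avg_x \avg_y F x y = \avg_y \avg_x F x y.
Proof. by rewrite /avg -!mulr_sumr exchange_big. Qed.

Lemma le_avg f g : (forall x, f x <= g x) -> avg f <= avg g.
Proof.
move=> fg; rewrite ler_wpM2l ?invr_ge0 ?ler0n //.
by apply: ler_sum => x _.
Qed.

Lemma avg_ge0 f : (forall x, 0 <= f x) -> 0 <= avg f.
Proof. by move=> f0; rewrite -(avg_cst 0); apply: le_avg. Qed.

Lemma reindex_avg (p : G -> G) f : injective p -> \avg_x f (p x) = avg f.
Proof. by move=> pI; rewrite /avg [in RHS](reindex_inj pI). Qed.

Lemma avg_addr t f : \avg_x f (x + t) = avg f.
Proof. by apply: (reindex_avg f (addIr t)). Qed.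

Lemma avg_addl t f : \avg_x f (t + x) = avg f.
Proof. by apply: (reindex_avg f (addrI t)). Qed.

Lemma avg_subl t f : \avg_x f (t - x) = avg f.
Proof.
apply: (reindex_avg (p := fun x => t - x) f).
by move=> x y /addrI /oppr_inj.
Qed.

Lemma avg_subr t f : \avg_x f (x - t) = avg f.
Proof. exact: avg_addr. Qed.

Lemma avg_opp f : \avg_x f (- x) = avg f.
Proof. by apply: (reindex_avg f (@oppr_inj G)). Qed.

Lemma avg_exists f : exists x, avg f <= f x.
Proof.
apply/existsP; apply: contraT; rewrite negb_exists => /forallP fl.
suff : avg f < avg f by rewrite ltxx.
rewrite -{2}(avg_cst (avg f)) {1 3}/avg.
rewrite ltr_pM2l ?invr_gt0 ?card_gt0R //.
apply: ltr_sum => [|x _]; last by rewrite ltNge fl.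
by apply/hasP; exists 0; rewrite ?mem_index_enum.
Qed.

(** Lagrange's identity: the mean of [(f x * g y - f y * g x) ^+ 2] over all pairs is twice the
    difference of the two sides. *)
Lemma avg_CS f g :
  (\avg_x (f x * g x)) ^+ 2 <= \avg_x (f x ^+ 2) * \avg_x (g x ^+ 2).
Proof.
have : 0 <= \avg_x \avg_y (f x * g y - f y * g x) ^+ 2.
  by apply: avg_ge0 => x; apply: avg_ge0 => y; rewrite sqr_ge0.
have -> : \avg_x \avg_y (f x * g y - f y * g x) ^+ 2 =
   \avg_x (f x ^+ 2 * \avg_y (g y ^+ 2) +
     (-2 * (f x * g x) * (\avg_y (f y * g y)) + g x ^+ 2 * \avg_y (f y ^+ 2))).
  apply: eq_avg => x; rewrite -!avgZ -!avgD; apply: eq_avg => y; ring.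
rewrite !avgD !avgZr avgZ; lra.
Qed.

Lemma avg_AMGM f g :
  \avg_x (f x * g x) <= (\avg_x (f x ^+ 2) + \avg_x (g x ^+ 2)) / 2.
Proof.
rewrite -avgD mulrC -avgZ; apply: le_avg => x.
have := sqr_ge0 (f x - g x); rewrite sqrrB; lra.
Qed.

Lemma avg_Jensen (b u : G -> R) : (forall x, 0 <= b x) -> avg b = 1 ->
  (\avg_x (b x * u x)) ^+ 2 <= \avg_x (b x * u x ^+ 2).
Proof.
move=> b0 b1; set m := \avg_x _.
have : 0 <= \avg_x (b x * (u x - m) ^+ 2).
  by apply: avg_ge0 => x; rewrite mulr_ge0 ?sqr_ge0.
have -> : \avg_x (b x * (u x - m) ^+ 2) =
   \avg_x (b x * u x ^+ 2 + (-2 * m * (b x * u x) + m ^+ 2 * b x)).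
  by apply: eq_avg => x; ring.
rewrite !avgD !avgZ b1 -/m; lra.
Qed.

(** * Autocorrelation and norms of convolution operators *)

Definition cor f d := \avg_x (f x * f (x + d)).

Lemma cor_opp f d : cor f (- d) = cor f d.
Proof.
rewrite /cor -(avg_addr d); apply: eq_avg => x.
by rewrite addrK mulrC.
Qed.

Lemma cor_sqr_le f d : cor f d ^+ 2 <= (\avg_x (f x ^+ 2)) ^+ 2.
Proof.
apply: le_trans (avg_CS _ _) _.
by rewrite (avg_addr d (fun x => f x ^+ 2)) -expr2; exact: lexx.
Qed.

(* [opb q e] says that the convolution operator of [q] has norm at most [e] on
   L^2; the arithmetic mean on the right avoids square roots. *)
Definition opb q (e : R) := forall u v,
  `|\avg_x \avg_y (u x * v y * q (x + y))|
    <= e * ((\avg_x (u x ^+ 2) + \avg_x (v x ^+ 2)) / 2).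

Lemma avg_sqr_cor v q : \avg_x (\avg_y (v y * q (x + y))) ^+ 2 =
  \avg_y (v y * \avg_z (v z * cor q (z - y))).
Proof.
transitivity (\avg_x \avg_y \avg_z (v y * v z * (q (x + y) * q (x + z)))).
  apply: eq_avg => x; rewrite expr2 -avgZr; apply: eq_avg => y.
  by rewrite -avgZ; apply: eq_avg => z; ring.
rewrite exchange_avg; apply: eq_avg => y.
rewrite exchange_avg -avgZ; apply: eq_avg => z.
rewrite avgZ mulrA; congr (_ * _).
rewrite /cor -[RHS](avg_addr y); apply: eq_avg => x.
by rewrite [z - y]addrC addrA addrK.
Qed.

Lemma avg_sqr_cor2 v q : (forall d, q (- d) = q d) ->
  (\avg_y (v y * \avg_z (v z * q (z - y)))) ^+ 2 <=
  \avg_x (v x ^+ 2) * \avg_y (v y * \avg_z (v z * cor q (z - y))).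
Proof.
move=> qN; apply: le_trans (avg_CS _ _) _; rewrite -avg_sqr_cor.
rewrite le_eqVlt; apply/orP; left; apply/eqP; congr (_ * _).
rewrite -[RHS]avg_opp; apply: eq_avg => x; congr (_ ^+ 2).
by apply: eq_avg => y; rewrite addrC.
Qed.

Lemma norm_le_of_sqr (a b : R) : 0 <= b -> a ^+ 2 <= b ^+ 2 -> `|a| <= b.
Proof.
by move=> b0 ab; rewrite -ler_sqr ?nnegrE // real_normK ?num_real.
Qed.

(** Three applications of Cauchy-Schwarz bound the eighth power of the form. In Fourier terms, the
    hypothesis bounds the sum of the eighth powers of the coefficients of [q], hence the largest of
    them. *)
Lemma opb_of_cor q e : 0 <= e ->
  \avg_d (cor (cor q) d ^+ 2) <= e ^+ 8 -> opb q e.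
Proof.
move=> e0 qe u v.
set U := \avg_x (u x ^+ 2); set V := \avg_x (v x ^+ 2).
have U0 : 0 <= U by apply: avg_ge0 => x; rewrite sqr_ge0.
have V0 : 0 <= V by apply: avg_ge0 => x; rewrite sqr_ge0.
have -> : \avg_x \avg_y (u x * v y * q (x + y)) =
          \avg_x (u x * \avg_y (v y * q (x + y))).
  by apply: eq_avg => x; rewrite -avgZ; apply: eq_avg => y; rewrite mulrA.
set B := avg _.
pose C := \avg_y (v y * \avg_z (v z * cor q (z - y))).
pose D := \avg_y (v y * \avg_z (v z * cor (cor q) (z - y))).
have hB : B ^+ 2 <= U * C by rewrite /C -avg_sqr_cor; apply: avg_CS.
have hC : C ^+ 2 <= V * D by apply: avg_sqr_cor2 => d; rewrite cor_opp.
have DE : D = \avg_d (cor (cor q) d * cor v d).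
  rewrite /D.
  transitivity (\avg_y \avg_d (cor (cor q) d * (v y * v (y + d)))).
    apply: eq_avg => y; rewrite -avgZ -(avg_addl y); apply: eq_avg => d.
    by rewrite (_ : y + d - y = d) ?[y + d]addrC ?addrK //; ring.
  by rewrite exchange_avg; apply: eq_avg => d; rewrite avgZ.
have hD : D ^+ 2 <= e ^+ 8 * V ^+ 2.
  rewrite DE; apply: le_trans (avg_CS _ _) _.
  apply: ler_pM => //; try by apply: avg_ge0 => d; rewrite sqr_ge0.
  by rewrite -[leRHS]avg_cst; apply: le_avg => d; apply: cor_sqr_le.
have hD' : D <= e ^+ 4 * V.
  apply: le_trans (ler_norm _) (norm_le_of_sqr _ _).
    by rewrite mulr_ge0 ?exprn_ge0.
  by apply: le_trans hD _; rewrite le_eqVlt; apply/orP; left; apply/eqP; ring.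
have hC' : C <= e ^+ 2 * V.
  apply: le_trans (ler_norm _) (norm_le_of_sqr _ _).
    by rewrite mulr_ge0 ?exprn_ge0.
  apply: le_trans hC (le_trans (ler_wpM2l V0 hD') _).
  by rewrite le_eqVlt; apply/orP; left; apply/eqP; ring.
apply: norm_le_of_sqr; first by rewrite mulr_ge0 // divr_ge0 // addr_ge0.
apply: le_trans hB _; apply: le_trans (ler_wpM2l U0 hC') _.
rewrite exprMn mulrCA ler_wpM2l ?sqr_ge0 //.
have := sqr_ge0 (U - V); rewrite sqrrB; lra.
Qed.

Lemma opb_ext q q' e : q =1 q' -> opb q e -> opb q' e.
Proof.
move=> qq hq u v; rewrite (_ : avg _ = \avg_x \avg_y (u x * v y * q (x + y))) //.
by apply: eq_avg => x; apply: eq_avg => y; rewrite qq.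
Qed.

Lemma opb_le q e e' : e <= e' -> opb q e -> opb q e'.
Proof.
move=> ee hq u v; apply: le_trans (hq u v) _.
by rewrite ler_wpM2r // divr_ge0 // addr_ge0 // avg_ge0 // => x; rewrite sqr_ge0.
Qed.

Lemma opbD q q' e e' : opb q e -> opb q' e' -> opb (fun x => q x + q' x) (e + e').
Proof.
move=> hq hq' u v.
have -> : \avg_x \avg_y (u x * v y * (q (x + y) + q' (x + y))) =
  \avg_x \avg_y (u x * v y * q (x + y)) + \avg_x \avg_y (u x * v y * q' (x + y)).
  by rewrite -avgD; apply: eq_avg => x; rewrite -avgD; apply: eq_avg => y; ring.
by rewrite mulrDl (le_trans (ler_normD _ _)) // lerD.
Qed.

Lemma opbN q e : opb q e -> opb (fun x => - q x) e.
Proof.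
move=> hq u v.
have -> : \avg_x \avg_y (u x * v y * - q (x + y)) =
  - \avg_x \avg_y (u x * v y * q (x + y)).
  by rewrite -avgN; apply: eq_avg => x; rewrite -avgN; apply: eq_avg => y; ring.
by rewrite normrN.
Qed.

(** The shift is absorbed into [v], whose L^2 norm is translation invariant. *)
Lemma opb_tr t q e : opb q e -> opb (fun x => q (x + t)) e.
Proof.
move=> hq u v; have := hq u (fun y => v (y - t)).
rewrite (avg_subr t (fun y => v y ^+ 2)).
congr (`|_| <= _); apply: eq_avg => x.
rewrite -[LHS](avg_addr t); apply: eq_avg => y.
by rewrite addrK addrA.
Qed.

Lemma opb_avg (b : G -> R) (Q : G -> G -> R) e :
  (forall t, 0 <= b t) -> avg b = 1 -> (forall t, b t != 0 -> opb (Q t) e) ->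
  opb (fun x => \avg_t (b t * Q t x)) e.
Proof.
move=> b0 b1 hQ u v; set M := _ / 2.
have -> : \avg_x \avg_y (u x * v y * \avg_t (b t * Q t (x + y))) =
  \avg_t (b t * \avg_x \avg_y (u x * v y * Q t (x + y))).
  transitivity (\avg_x \avg_y \avg_t (b t * (u x * v y * Q t (x + y)))).
    apply: eq_avg => x; apply: eq_avg => y; rewrite -avgZ.
    by apply: eq_avg => t; ring.
  transitivity (\avg_x \avg_t \avg_y (b t * (u x * v y * Q t (x + y)))).
    by apply: eq_avg => x; rewrite exchange_avg.
  rewrite exchange_avg; apply: eq_avg => t; rewrite -avgZ.
  by apply: eq_avg => x; rewrite avgZ.
have hb t : `|b t * \avg_x \avg_y (u x * v y * Q t (x + y))| <= b t * (e * M).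
  rewrite normrM ger0_norm //.
  have [->|bt] := eqVneq (b t) 0; first by rewrite !mul0r.
  by rewrite ler_wpM2l // hQ.
rewrite -[e * M]mul1r -b1 -avgZr ler_norml; apply/andP; split.
  rewrite -avgN; apply: le_avg => t.
  by have := hb t; rewrite ler_norml => /andP[].
apply: le_avg => t.
by have := hb t; rewrite ler_norml => /andP[].
Qed.

Lemma opb_trD f s t e e' : opb (fun x => f (x + s) - f x) e ->
  opb (fun x => f (x + t) - f x) e' ->
  opb (fun x => f (x + (s + t)) - f x) (e + e').
Proof.
move=> hs ht; apply: opb_ext (opbD (opb_tr t hs) ht) => x /=.
by rewrite [s + t]addrC (addrA x); ring.
Qed.

Lemma opb_trN f t e : opb (fun x => f (x + t) - f x) e ->
  opb (fun x => f (x - t) - f x) e.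
Proof.
move=> ht; apply: opb_ext (opbN (opb_tr (- t) ht)) => x /=.
by rewrite subrK opprB.
Qed.

Lemma opb_trM f t e n : 0 <= e -> opb (fun x => f (x + t) - f x) e ->
  opb (fun x => f (x + t *+ n) - f x) (e *+ n).
Proof.
move=> e0 ht; elim: n => [|n IH].
  apply: (@opb_ext (fun x => 0)) => [x|u v].
    by rewrite mulr0n addr0 subrr.
  rewrite mulr0n mul0r (_ : avg _ = 0) ?normr0 // -[RHS]avg_cst.
  apply: eq_avg => x; rewrite -[RHS]avg_cst; apply: eq_avg => y.
  by rewrite mulr0.
by rewrite !mulrS; apply: opb_trD.
Qed.

Lemma cor_tr f a b : \avg_x (f (x + a) * f (x + b)) = cor f (b - a).
Proof.
rewrite /cor -[RHS](avg_addr a); apply: eq_avg => x.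
by rewrite addrACA [a - a]subrr addr0.
Qed.

(** Autocorrelation turns the second difference of [f] into the twice iterated second difference of
    [cor f]. Combined with [cor_difference], this expresses [cor (cor _)] of a first difference
    through [cor (cor f)]. *)
Lemma cor_second_difference f t d :
  cor (fun x => 2 * f x - f (x + t) - f (x - t)) d =
    2 * (2 * cor f d - cor f (d + t) - cor f (d - t)) -
    (2 * cor f (d + t) - cor f (d + t + t) - cor f (d + t - t)) -
    (2 * cor f (d - t) - cor f (d - t + t) - cor f (d - t - t)).
Proof.
rewrite {1}/cor.
transitivity (\avg_x (4 * (f (x + 0) * f (x + d)) +
   (-2 * (f (x + 0) * f (x + (d + t))) + (-2 * (f (x + 0) * f (x + (d - t))) +
   (-2 * (f (x + t) * f (x + d)) + (f (x + t) * f (x + (d + t)) +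
   (f (x + t) * f (x + (d - t)) + (-2 * (f (x - t) * f (x + d)) +
   (f (x - t) * f (x + (d + t)) + f (x - t) * f (x + (d - t))))))))))).
  by apply: eq_avg => x; rewrite addr0 !addrA; ring.
rewrite !avgD !avgZ !cor_tr !subr0 !opprK !addrK !subrK.
ring.
Qed.

Lemma cor_difference f t d :
  cor (fun x => f (x + t) - f x) d = 2 * cor f d - cor f (d + t) - cor f (d - t).
Proof.
rewrite {1}/cor.
transitivity (\avg_x (f (x + t) * f (x + (d + t)) + (-1 * (f (x + t) * f (x + d))
   + (-1 * (f (x + 0) * f (x + (d + t))) + f (x + 0) * f (x + d))))).
  by apply: eq_avg => x; rewrite addr0 !addrA; ring.
rewrite !avgD !avgZ !cor_tr !subr0 !addrK; ring.
Qed.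

Lemma eq_cor f g : f =1 g -> cor f =1 cor g.
Proof. by move=> fg d; apply: eq_avg => x; rewrite !fg. Qed.

(** The double autocorrelation of the difference is the second-difference operator applied twice to
    [w = cor (cor f)]. The inner application costs a factor 4 against the mean square of
    [w (x + t) - w x], the outer one a factor 16. *)
Lemma opb_difference f t e : 0 <= e ->
  64 * \avg_x ((cor (cor f) (x + t) - cor (cor f) x) ^+ 2) <= e ^+ 8 ->
  opb (fun x => f (x + t) - f x) e.
Proof.
move=> e0; set w := cor (cor f) => he; apply: opb_of_cor => //.
apply: le_trans he.
pose E d := 2 * w d - w (d + t) - w (d - t).
have hE : \avg_d (E d ^+ 2) <= 4 * \avg_x ((w (x + t) - w x) ^+ 2).
  have h2 : \avg_x ((w (x - t) - w x) ^+ 2) = \avg_x ((w (x + t) - w x) ^+ 2).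
    rewrite -(avg_addr t); apply: eq_avg => x.
    by rewrite addrK -sqrrN opprB.
  have -> : 4 * \avg_x ((w (x + t) - w x) ^+ 2) =
     \avg_x (2 * (w (x + t) - w x) ^+ 2 + 2 * (w (x - t) - w x) ^+ 2).
    by rewrite avgD !avgZ h2; ring.
  apply: le_avg => d; rewrite /E.
  have := sqr_ge0 (w (d + t) - w (d - t)); lra.
have -> : \avg_d (cor (cor (fun x => f (x + t) - f x)) d ^+ 2) =
    \avg_d ((2 * E d - E (d + t) - E (d - t)) ^+ 2).
  apply: eq_avg => d; rewrite (eq_cor (cor_difference f t)).
  by rewrite cor_second_difference.
apply: (@le_trans _ _ (16 * \avg_d (E d ^+ 2))); last by lra.
have -> : 16 * \avg_d (E d ^+ 2) =
  \avg_d (8 * E d ^+ 2 + (4 * E (d + t) ^+ 2 + 4 * E (d - t) ^+ 2)).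
  rewrite !avgD !avgZ (avg_addr t (fun d => E d ^+ 2)).
  by rewrite (avg_addr (- t) (fun d => E d ^+ 2)); ring.
apply: le_avg => d.
have := sqr_ge0 (E (d + t) - E (d - t)).
have := sqr_ge0 (2 * E d + (E (d + t) + E (d - t))).
lra.
Qed.

(** * Random sampling and almost periods *)

(* [smp h k phi] is the mean of [phi] over [k] independent samples from the
   probability density [h]. *)
Fixpoint smp h k (phi : seq G -> R) : R :=
  if k is k'.+1 then \avg_y (h y * smp h k' (fun s => phi (y :: s)))
  else phi [::].

Lemma eq_smp h k phi psi : (forall s, phi s = psi s) -> smp h k phi = smp h k psi.
Proof.
elim: k phi psi => [|k IH] phi psi pp //=.
by apply: eq_avg => y; congr (_ * _); apply: IH.
Qed.

Lemma le_smp h k phi psi : (forall x, 0 <= h x) -> (forall s, phi s <= psi s) ->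
  smp h k phi <= smp h k psi.
Proof.
move=> h0; elim: k phi psi => [|k IH] phi psi pp //=.
by apply: le_avg => y; rewrite ler_wpM2l // IH.
Qed.

Lemma smp_affine h k a c phi : avg h = 1 ->
  smp h k (fun s => a + c * phi s) = a + c * smp h k phi.
Proof.
move=> h1; elim: k phi => [|k IH] phi //=.
rewrite -avgZ -[X in X + _]mul1r -h1 -avgZr -avgD; apply: eq_avg => y.
by rewrite IH; ring.
Qed.

Lemma smp_cst h k c : avg h = 1 -> smp h k (fun=> c) = c.
Proof.
by move=> h1; elim: k => [|k IH] //=; rewrite avgZr h1 mul1r IH.
Qed.

Lemma smp_avg h k (phi : G -> seq G -> R) :
  smp h k (fun s => \avg_x phi x s) = \avg_x smp h k (phi x).
Proof.
elim: k phi => [|k IH] phi //=; rewrite exchange_avg.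
by apply: eq_avg => y; rewrite avgZ -IH.
Qed.

(** The cross terms vanish because the samples are independent and [X] is centred; the offset [a] is
    there for the induction. *)
Lemma smp_variance h k X a : avg h = 1 -> \avg_y (h y * X y) = 0 ->
  smp h k (fun s => (a + \sum_(y <- s) X y) ^+ 2) =
    a ^+ 2 + k%:R * \avg_y (h y * X y ^+ 2).
Proof.
move=> h1 X0; elim: k a => [|k IH] a /=; first by rewrite big_nil; ring.
transitivity (\avg_y (h y * (a ^+ 2 + k%:R * \avg_y (h y * X y ^+ 2)) +
    (2 * a * (h y * X y) + h y * X y ^+ 2))).
  apply: eq_avg => y.
  rewrite (@eq_smp _ _ _ (fun s => (a + X y + \sum_(y <- s) X y) ^+ 2)).
    by rewrite IH; ring.
  by move=> s; rewrite big_cons addrA.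
by rewrite !avgD avgZr avgZ X0 h1 -natr1; ring.
Qed.

(** Change of measure: Cauchy-Schwarz in each sample replaces the density [h] by the uniform one at
    the cost of its second moment. For an indicator [phi], a lower bound on its probability passes
    to uniform samples, which may be translated freely. *)
Lemma smp_CS h k phi : (smp h k phi) ^+ 2 <=
  (\avg_x (h x ^+ 2)) ^+ k * smp (fun=> 1) k (fun s => phi s ^+ 2).
Proof.
have h0 : 0 <= \avg_x (h x ^+ 2) by apply: avg_ge0 => x; rewrite sqr_ge0.
elim: k phi => [|k IH] phi /=; first by rewrite mul1r.
apply: le_trans (avg_CS _ _) _; rewrite exprS -mulrA ler_wpM2l //.
by rewrite -avgZ; apply: le_avg => y; rewrite mul1r IH.
Qed.

Lemma smp1_shift k t phi :
  smp (fun=> 1) k (fun s => phi [seq y + t | y <- s]) = smp (fun=> 1) k phi.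
Proof.
elim: k phi => [|k IH] phi //=.
rewrite -[RHS](avg_addr t); apply: eq_avg => y; congr (_ * _).
by rewrite -[RHS]IH.
Qed.

Lemma smp1_exists k phi :
  exists2 s, size s = k & smp (fun=> 1) k phi <= phi s.
Proof.
elim: k phi => [|k IH] phi /=; first by exists [::].
have [y hy] := avg_exists (fun y => 1 * smp (fun=> 1) k (fun s => phi (y :: s))).
have [s sk hs] := IH (fun s => phi (y :: s)).
exists (y :: s); first by rewrite /= sk.
by apply: le_trans hy _; rewrite mul1r.
Qed.

(* Croot-Sisask: [cor h] is approximated in L^2 by the mean of k random
   translates of [h]; many simultaneous shifts of one sample remain good. *)
Lemma many_almost_periods h K k : (forall x, 0 <= h x) -> avg h = 1 ->
  \avg_x (h x ^+ 2) <= K -> (0 < k)%N ->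
  exists2 T : {set G}, (4 * K ^+ k)^-1 * #|G|%:R <= #|T|%:R &
    forall t, t \in T -> \avg_x ((cor h (x + t) - cor h x) ^+ 2) <= 8 * K / k%:R.
Proof.
move=> h0 h1 hK k0; set w := cor h.
have kR : 0 < k%:R :> R by rewrite ltr0n.
have H1 : 1 <= \avg_x (h x ^+ 2).
  rewrite -h1 -ler_sqr ?nnegrE ?avg_ge0 // => [|x]; last exact: sqr_ge0.
  have := avg_CS h (fun=> 1); rewrite expr1n avg_cst mulr1.
  rewrite (@eq_avg _ h) ?h1 => [|x]; last by rewrite mulr1.
  by rewrite expr1n => H; rewrite -[leLHS]mulr1 expr2 ler_pM // (le_trans _ H).
have K1 : 1 <= K by apply: le_trans hK.
have K0 : 0 < K by apply: lt_le_trans K1.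
have Kk : 0 < K ^+ k by rewrite exprn_gt0.
pose X x y := h (y + x) - w x.
pose phi s := \avg_x (\sum_(y <- s) X x y) ^+ 2.
have X0 x : \avg_y (h y * X x y) = 0.
  transitivity (\avg_y (h y * h (y + x) - h y * w x)).
    by apply: eq_avg => y; rewrite /X; ring.
  by rewrite avgB avgZr h1 mul1r subrr.
(* For each [x] the variance of one sample is at most its second moment, and averaging over [x]
   turns the latter into the mean square of [h]. *)
have hphi : smp h k phi <= k%:R * K.
  rewrite /phi smp_avg.
  have -> : \avg_x smp h k (fun s => (\sum_(y <- s) X x y) ^+ 2) =
     \avg_x (k%:R * \avg_y (h y * X x y ^+ 2)).
    apply: eq_avg => x.
    rewrite (@eq_smp _ _ _ (fun s => (0 + \sum_(y <- s) X x y) ^+ 2)).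
      by rewrite smp_variance // expr0n add0r.
    by move=> s; rewrite add0r.
  rewrite avgZ ler_wpM2l //; apply: le_trans hK.
  have -> : \avg_x (h x ^+ 2) = \avg_x \avg_y (h y * h (y + x) ^+ 2).
    rewrite exchange_avg -[LHS]mul1r -h1 -avgZr; apply: eq_avg => y.
    by rewrite avgZ (avg_addl y (fun x => h x ^+ 2)).
  apply: le_avg => x.
  have -> : \avg_y (h y * h (y + x) ^+ 2) =
    \avg_y (h y * X x y ^+ 2 + (2 * w x * (h y * X x y) + h y * w x ^+ 2)).
    by apply: eq_avg => y; rewrite /X; ring.
  by rewrite !avgD avgZ X0 avgZr h1 mulr0 add0r mul1r lerDl sqr_ge0.
have phi0 s : 0 <= phi s by apply: avg_ge0 => x; rewrite sqr_ge0.
pose Y s : R := (phi s <= 2 * (k%:R * K))%R%:R.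
(* Markov's inequality: a sample has error at most twice the bound on the mean with probability at
   least 1/2. *)
have hY : 2^-1 <= smp h k Y.
  have c0 : 0 < 2 * (k%:R * K) by rewrite !mulr_gt0.
  have := smp_affine k 1 (- (2 * (k%:R * K))^-1) phi h1 => E.
  apply: (@le_trans _ _ (1 + - (2 * (k%:R * K))^-1 * smp h k phi)).
    have : (2 * (k%:R * K))^-1 * smp h k phi <= 2^-1.
      by rewrite ler_pdivrMl //; lra.
    by rewrite mulNr; lra.
  rewrite -E; apply: le_smp => // s; rewrite /Y; case: (leP (phi s)) => /= H.
    by rewrite gerDl mulNr oppr_le0 mulr_ge0 // invr_ge0 ltW.
  have : 1 <= (2 * (k%:R * K))^-1 * phi s by rewrite ler_pdivlMl // mulr1 ltW.
  by rewrite mulNr; lra.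
have hJ : (4 * K ^+ k)^-1 <= smp (fun=> 1) k Y.
  have := smp_CS h k Y.
  rewrite (@eq_smp _ _ _ Y) => [|s]; last by rewrite /Y; case: (leP (phi s)); rewrite ?expr0n ?expr1n.
  set J := smp (fun=> 1) k Y => HJ.
  have J0 : 0 <= J.
    by rewrite -(smp_cst k 0 (avg_cst 1)); apply: le_smp.
  have : (\avg_x (h x ^+ 2)) ^+ k * J <= K ^+ k * J.
    by rewrite ler_wpM2r // lerXn2r // nnegrE ?(le_trans ler01) // ltW.
  have : 2^-1 ^+ 2 <= smp h k Y ^+ 2 by rewrite !expr2 ler_pM ?invr_ge0.
  move=> A B; rewrite invfM ler_pdivrMr //; lra.
(* Uniform sampling is translation invariant, so some fixed sample [s] has at least this proportion
   of good shifts. *)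
have [s sk hs] : exists2 s, size s = k &
    (4 * K ^+ k)^-1 <= \avg_t Y [seq y + t | y <- s].
  have [s sk hs] := smp1_exists k (fun s => \avg_t Y [seq y + t | y <- s]).
  exists s => //; apply: le_trans hs; rewrite smp_avg; apply: le_trans hJ _.
  rewrite -[leLHS]avg_cst le_eqVlt; apply/orP; left; apply/eqP.
  by apply: eq_avg => t; rewrite smp1_shift.
pose S := [set t | phi [seq y + t | y <- s] <= 2 * (k%:R * K)].
have hS : (4 * K ^+ k)^-1 * #|G|%:R <= #|S|%:R.
  rewrite -ler_pdivlMr ?card_gt0R // [leRHS]mulrC; apply: le_trans hs _.
  rewrite /avg ler_wpM2l ?invr_ge0 // -sum1_card natr_sum [leRHS]big_mkcond /=.
  by apply: ler_sum => t _; rewrite inE /Y; case: (leP (phi _)).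
have [t0 t0S] : exists t0, t0 \in S.
  apply/set0Pn; apply: contraTneq hS => ->; rewrite cards0 -ltNge.
  by rewrite mulr_gt0 ?card_gt0R // invr_gt0 mulr_gt0.
(* Two good shifts of the same [s] approximate two translates of [w] by one and the same sum; hence
   the difference from a fixed good shift [t0] is an almost period. *)
exists [set t0 - t | t in S].
  by rewrite card_imset // => x y /addrI /oppr_inj.
move=> _ /imsetP[t tS ->].
have phiE r : phi [seq y + r | y <- s] =
    \avg_x (\sum_(y <- s) h (y + x) - k%:R * w (x - r)) ^+ 2.
  rewrite /phi -(avg_subr r); apply: eq_avg => x; congr (_ ^+ 2).
  rewrite big_map /X sumrB; congr (_ - _).
    by apply: eq_bigr => y _; rewrite addrA addrAC addrK.
  by rewrite big_const_seq count_predT sk iter_addr_0 mulr_natl.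
move: t0S tS; rewrite !inE !phiE => A B.
have -> : \avg_x (w (x + (t0 - t)) - w x) ^+ 2 =
    \avg_x (w (x - t) - w (x - t0)) ^+ 2.
  by rewrite -(avg_subr t0); apply: eq_avg => x; rewrite addrA subrK.
rewrite -(ler_pM2l (exprn_gt0 2 kR)).
have -> : k%:R ^+ 2 * (8 * K / k%:R) = 4 * (2 * (k%:R * K)) :> R.
  by field; rewrite gt_eqF.
have: \avg_x ((k%:R * w (x - t) - k%:R * w (x - t0)) ^+ 2) <=
   \avg_x (2 * (\sum_(y <- s) h (y + x) - k%:R * w (x - t0)) ^+ 2 +
     2 * (\sum_(y <- s) h (y + x) - k%:R * w (x - t)) ^+ 2).
  apply: le_avg => x; set a := \sum_(y <- s) _.
  have := sqr_ge0 (2 * a - k%:R * w (x - t) - k%:R * w (x - t0)); lra.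
rewrite avgD !avgZ (@eq_avg (fun x => (_ - _) ^+ 2)
   (fun x => k%:R ^+ 2 * (w (x - t) - w (x - t0)) ^+ 2)); last by move=> x; ring.
by rewrite avgZ; lra.
Qed.

Lemma avg_cor f : avg (cor f) = avg f ^+ 2.
Proof.
rewrite /cor exchange_avg expr2 -avgZr; apply: eq_avg => x.
by rewrite avgZ avg_addl.
Qed.

Lemma avg_delta f y : \avg_z (f z * (#|G|%:R * (z == y)%:R)) = f y.
Proof.
transitivity (\avg_z (#|G|%:R * (f z * (z == y)%:R))).
  by apply: eq_avg => z; ring.
rewrite avgZ /avg mulrA mulfV ?gt_eqF ?card_gt0R // mul1r (bigD1 y) //= eqxx.
by rewrite mulr1 big1 ?addr0 // => z /negPf ->; rewrite mulr0.
Qed.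

(** * Smoothing by a density and the energy increment *)

Definition smo (b : G -> R) f x := \avg_t (b t * f (x + t)).
Definition smon (b : G -> R) f x := \avg_t (b t * f (x - t)).
(* Averaging over the differences [t - t'] makes [sm2 b] a positive operator,
   which is what the energy increment needs. *)
Definition sm2 (b : G -> R) f := smo b (smon b f).

Lemma smonE b f x : smon b f x = smo (fun t => b (- t)) f x.
Proof. by rewrite /smo -avg_opp; apply: eq_avg => t; rewrite opprK. Qed.

Lemma smo_adjoint b u v : \avg_x (u x * smo b v x) = \avg_x (smon b u x * v x).
Proof.
transitivity (\avg_x \avg_t (b t * (u x * v (x + t)))).
  by apply: eq_avg => x; rewrite -avgZ; apply: eq_avg => t; ring.
rewrite exchange_avg.
transitivity (\avg_t \avg_x (b t * (u (x - t) * v x))).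
  apply: eq_avg => t; rewrite -[RHS](avg_addr t).
  by apply: eq_avg => x; rewrite addrK.
rewrite exchange_avg; apply: eq_avg => x; rewrite -avgZr.
by apply: eq_avg => t; ring.
Qed.

Section Density.
Variable b : G -> R.
Hypotheses (b_ge0 : forall t, 0 <= b t) (b_avg : avg b = 1).

Lemma avg_smo f : avg (smo b f) = avg f.
Proof.
rewrite /smo exchange_avg -[RHS]mul1r -b_avg -avgZr; apply: eq_avg => t.
by rewrite avgZ avg_addr.
Qed.

Lemma avg_smon f : avg (smon b f) = avg f.
Proof.
rewrite /smon exchange_avg -[RHS]mul1r -b_avg -avgZr; apply: eq_avg => t.
by rewrite avgZ avg_subr.
Qed.

Lemma smo_ge0 f : (forall x, 0 <= f x) -> forall x, 0 <= smo b f x.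
Proof. by move=> f0 x; apply: avg_ge0 => t; rewrite mulr_ge0. Qed.

Lemma smon_ge0 f : (forall x, 0 <= f x) -> forall x, 0 <= smon b f x.
Proof. by move=> f0 x; apply: avg_ge0 => t; rewrite mulr_ge0. Qed.

Lemma smo_contract f : \avg_x (smo b f x ^+ 2) <= \avg_x (f x ^+ 2).
Proof.
apply: (@le_trans _ _ (\avg_x smo b (fun x => f x ^+ 2) x)).
  by apply: le_avg => x; apply: avg_Jensen.
by rewrite avg_smo.
Qed.

Lemma smon_contract f : \avg_x (smon b f x ^+ 2) <= \avg_x (f x ^+ 2).
Proof.
apply: (@le_trans _ _ (\avg_x smon b (fun x => f x ^+ 2) x)).
  by apply: le_avg => x; apply: avg_Jensen.
by rewrite avg_smon.
Qed.

Lemma sm2_contract f : \avg_x (sm2 b f x ^+ 2) <= \avg_x (f x ^+ 2).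
Proof. exact: le_trans (smo_contract _) (smon_contract _). Qed.

(** The autocorrelation of [smo b v] or of [smon b v] is [sm2 b] applied to the autocorrelation of
    [v], and [sm2 b] contracts L^2. *)
Lemma cor_sm2_le f : \avg_x (cor (sm2 b f) x ^+ 2) <= \avg_x (cor f x ^+ 2).
Proof.
have cE v d : cor (smo b v) d = smo b (smon b (cor v)) d.
  rewrite {1}/cor /smo.
  transitivity (\avg_x \avg_s \avg_t (b s * b t * (v (x + t) * v (x + (d + s))))).
    apply: eq_avg => x; rewrite mulrC -avgZr; apply: eq_avg => s.
    by rewrite -avgZ; apply: eq_avg => t; rewrite addrA; ring.
  rewrite exchange_avg; apply: eq_avg => s.
  rewrite exchange_avg /smon -avgZ; apply: eq_avg => t.
  by rewrite avgZ cor_tr mulrA.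
have cE' v d : cor (smon b v) d = smo b (smon b (cor v)) d.
  rewrite {1}/cor /smon.
  transitivity (\avg_x \avg_s \avg_t (b s * b t * (v (x - s) * v (x + (d - t))))).
    apply: eq_avg => x; rewrite -avgZr; apply: eq_avg => s.
    by rewrite -avgZ; apply: eq_avg => t; rewrite addrA; ring.
  rewrite exchange_avg; apply: eq_avg => s.
  rewrite exchange_avg -avgZ; apply: eq_avg => t.
  by rewrite avgZ cor_tr mulrA opprK addrAC.
apply: (@le_trans _ _ (\avg_x (cor (smon b f) x ^+ 2))).
  by rewrite (eq_avg (fun x => congr1 (fun y => y ^+ 2) (cE _ x))) sm2_contract.
by rewrite (eq_avg (fun x => congr1 (fun y => y ^+ 2) (cE' _ x))) sm2_contract.
Qed.

(** Expanding the square gives an average of [cor f] over differences of two points weighted by [b].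
    The constant part contributes [D], and the spike at 0 contributes [L] times the second moment of
    [b]. *)
Lemma smon_L2 f D L : (forall x, 0 <= f x) ->
  (forall d, cor f d <= D + L * (#|G|%:R * (d == 0)%:R)) ->
  \avg_x (smon b f x ^+ 2) <= D + L * \avg_x (b x ^+ 2).
Proof.
move=> f0 hf; pose v t := b (- t).
rewrite (eq_avg (fun x => congr1 (fun y => y ^+ 2) (smonE _ _ x))) avg_sqr_cor.
have -> : D + L * \avg_x (b x ^+ 2) = \avg_y (v y * (D + L * v y)).
  transitivity (\avg_y (v y * D + L * (v y ^+ 2))); last first.
    by apply: eq_avg => y; ring.
  by rewrite avgD avgZr avgZ (avg_opp b) (avg_opp (fun x => b x ^+ 2)) b_avg mul1r.
apply: le_avg => y; rewrite ler_wpM2l // /v.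
have -> : D + L * b (- y) =
    \avg_z (v z * D + L * (v z * (#|G|%:R * (z == y)%:R))).
  by rewrite avgD avgZr avgZ avg_delta (avg_opp b) b_avg mul1r.
apply: le_avg => z.
have -> : v z * D + L * (v z * (#|G|%:R * (z == y)%:R)) =
    v z * (D + L * (#|G|%:R * (z - y == 0)%:R)) by rewrite subr_eq0; ring.
by rewrite ler_wpM2l // /v.
Qed.

Lemma opb_smo q e : opb q e -> opb (smo b q) e.
Proof. by move=> hq; apply: opb_avg => // t _; apply: opb_tr. Qed.

Lemma opb_smon q e : opb q e -> opb (smon b q) e.
Proof. by move=> hq; apply: opb_avg => // t _; apply: opb_tr. Qed.

Lemma opb_sm2 f e : (forall t, b t != 0 -> opb (fun x => f (x + t) - f x) e) ->
  opb (fun x => sm2 b f x - f x) (e + e).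
Proof.
move=> hb.
have h1 : opb (fun x => smo b f x - f x) e.
  apply: opb_ext (opb_avg b_ge0 b_avg hb) => x.
  rewrite -[X in _ - X]mul1r -b_avg -avgZr -avgB.
  by apply: eq_avg => t; rewrite mulrBr.
have h2 : opb (fun x => smon b f x - f x) e.
  have hb' t : b t != 0 -> opb (fun x => f (x - t) - f x) e.
    by move=> bt; apply/opb_trN/hb.
  apply: opb_ext (opb_avg b_ge0 b_avg hb') => x.
  rewrite -[X in _ - X]mul1r -b_avg -avgZr -avgB.
  by apply: eq_avg => t; rewrite mulrBr.
apply: opb_ext (opbD (opb_smo h2) h1) => x.
rewrite /sm2 {1}/smo (_ : avg _ = smo b (smon b f) x - smo b f x).
  by rewrite addrA subrK.
by rewrite -avgB; apply: eq_avg => t; rewrite mulrBr.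
Qed.

End Density.

(** The form of [q] is tested on [b] and on [smo b q]; scaling the latter by the inverse of [e]
    balances the two terms of the arithmetic mean when the claim is tight. *)
Lemma opb_smo_norm b q e : 0 < e -> opb q e ->
  \avg_x (smo b q x ^+ 2) <= e ^+ 2 * \avg_x (b x ^+ 2).
Proof.
move=> e0 hq; set Z := \avg_x _; set M := \avg_x (b x ^+ 2).
have := hq (fun x => e^-1 * smo b q x) b.
have -> : \avg_x \avg_y (e^-1 * smo b q x * b y * q (x + y)) = e^-1 * Z.
  rewrite -avgZ; apply: eq_avg => x.
  by rewrite expr2 mulrA {3}/smo -avgZ; apply: eq_avg => y; rewrite mulrA.
have -> : \avg_x ((e^-1 * smo b q x) ^+ 2) = e^-1 ^+ 2 * Z.
  by rewrite -avgZ; apply: eq_avg => x; rewrite exprMn.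
rewrite -/M => h; have {h} := le_trans (ler_norm _) h.
rewrite -(ler_pM2l e0) mulVKf ?gt_eqF // => h.
have -> : Z = 2 * Z - Z by ring.
have {h} : 2 * Z <= Z + e ^+ 2 * M.
  apply: (@le_trans _ _ (2 * (e * (e * ((e^-1 ^+ 2 * Z + M) / 2))))); first by lra.
  by rewrite le_eqVlt; apply/orP; left; apply/eqP; field; rewrite gt_eqF.
lra.
Qed.

(** With [u = sm2 g f], adjointness and contraction give [|u|^2 <= <f, u>]. Replacing [f] by
    [sm2 g' f] in this scalar product would give a Pythagorean inequality; the error
    [<sm2 g' f - f, u>] is small because [u] is a convolution of [smon g f] with [g], so the
    operator norm controls it. *)
Lemma energy_increment f g g' e B M :
  (forall t, 0 <= g t) -> avg g = 1 -> 0 <= e ->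
  opb (fun x => sm2 g' f x - f x) e ->
  \avg_x (smon g f x ^+ 2) <= B -> \avg_x (g x ^+ 2) <= M ->
  \avg_x ((sm2 g' f x - sm2 g f x) ^+ 2) <=
    \avg_x (sm2 g' f x ^+ 2) - \avg_x (sm2 g f x ^+ 2) + e * (B + M).
Proof.
move=> g0 g1 e0 hq hB hM; pose q x := sm2 g' f x - f x.
have -> : \avg_x ((sm2 g' f x - sm2 g f x) ^+ 2) =
  \avg_x (sm2 g' f x ^+ 2) + \avg_x (sm2 g f x ^+ 2)
    - 2 * \avg_x (f x * sm2 g f x) - 2 * \avg_x (q x * sm2 g f x).
  rewrite -!avgZ -avgD -!avgB; apply: eq_avg => x; rewrite /q; ring.
have h1 : \avg_x (sm2 g f x ^+ 2) <= \avg_x (f x * sm2 g f x).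
  rewrite /sm2 smo_adjoint; apply: le_trans (smo_contract g0 g1 _) _.
  by rewrite le_eqVlt; apply/orP; left; apply/eqP; apply: eq_avg => x; rewrite expr2.
have h2 : `|\avg_x (q x * sm2 g f x)| <= e * ((B + M) / 2).
  apply: le_trans (_ : e * ((\avg_x (smon g f x ^+ 2) + \avg_x (g (- x) ^+ 2)) / 2)
     <= _); last first.
    rewrite ler_wpM2l // ler_pM2r ?invr_gt0 // lerD //.
    by rewrite (avg_opp (fun x => g x ^+ 2)).
  apply: le_trans (hq (smon g f) (fun t => g (- t))).
  rewrite /sm2 smo_adjoint le_eqVlt; apply/orP; left; apply/eqP; congr `|_|.
  apply: eq_avg => x; rewrite smonE mulrC -avgZ; apply: eq_avg => t.
  by rewrite mulrA.
have := ler_norm (- \avg_x (q x * sm2 g f x)); rewrite normrN; lra.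
Qed.

(** * The form counting solutions of [a + b + c + d + v = 0] *)

Definition lam (F1 F2 F3 F4 F5 : G -> R) := \avg_a \avg_b \avg_c \avg_d
  (F1 a * F2 b * F3 c * F4 d * F5 (- (a + b + c + d))).

Lemma lam_swap12 F1 F2 F3 F4 F5 : lam F1 F2 F3 F4 F5 = lam F2 F1 F3 F4 F5.
Proof.
rewrite /lam exchange_avg; apply: eq_avg => b; apply: eq_avg => a.
apply: eq_avg => c; apply: eq_avg => d.
by rewrite [F2 b * _]mulrC [b + a]addrC.
Qed.

Lemma lam_swap23 F1 F2 F3 F4 F5 : lam F1 F2 F3 F4 F5 = lam F1 F3 F2 F4 F5.
Proof.
rewrite /lam; apply: eq_avg => a; rewrite exchange_avg.
apply: eq_avg => c; apply: eq_avg => b; apply: eq_avg => d.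
by rewrite [F1 a * _ * _]mulrAC [a + b + c]addrAC.
Qed.

Lemma lam_swap34 F1 F2 F3 F4 F5 : lam F1 F2 F3 F4 F5 = lam F1 F2 F4 F3 F5.
Proof.
rewrite /lam; apply: eq_avg => a; apply: eq_avg => b.
rewrite exchange_avg; apply: eq_avg => d; apply: eq_avg => c.
by rewrite [_ * F3 c * _]mulrAC [a + b + c + d]addrAC.
Qed.

Lemma lam_swap45 F1 F2 F3 F4 F5 : lam F1 F2 F3 F4 F5 = lam F1 F2 F3 F5 F4.
Proof.
rewrite /lam; apply: eq_avg => a; apply: eq_avg => b; apply: eq_avg => c.
rewrite -[LHS](avg_subl (- (a + b + c))); apply: eq_avg => d.
by rewrite addNKr opprK -opprD; ring.
Qed.

(** The mean square of a convolution is the scalar product of the two autocorrelations. *)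
Lemma avg_conv_le F1 F2 K : \avg_x (cor F1 x ^+ 2) <= K ->
  \avg_x (cor F2 x ^+ 2) <= K ->
  \avg_z ((\avg_a (F1 a * F2 (z - a))) ^+ 2) <= K.
Proof.
move=> h1 h2.
have -> : \avg_z ((\avg_a (F1 a * F2 (z - a))) ^+ 2) =
    \avg_d (cor F1 d * cor F2 d).
  rewrite (@eq_avg _ (fun z => (\avg_a (F1 (- a) * F2 (z + a))) ^+ 2)); last first.
    move=> z; congr (_ ^+ 2); rewrite -avg_opp.
    by apply: eq_avg => a; rewrite opprK.
  rewrite avg_sqr_cor.
  transitivity (\avg_y \avg_d (F1 (- y) * F1 (- y + d) * cor F2 d)).
    apply: eq_avg => y; rewrite -avgZ -[LHS](avg_subl y); apply: eq_avg => d.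
    rewrite (_ : y - d - y = - d); last by rewrite addrAC subrr add0r.
    by rewrite cor_opp opprB [d - y]addrC mulrA.
  rewrite exchange_avg; apply: eq_avg => d; rewrite avgZr; congr (_ * _).
  by rewrite -avg_opp; apply: eq_avg => y; rewrite opprK.
apply: le_trans (avg_AMGM _ _) _; lra.
Qed.

(** Pairing [F1] with [F2] and [F3] with [F4] leaves the convolution operator of [F5] between two
    convolutions, whose L^2 norms are controlled by [avg_conv_le]. *)
Lemma lam_le F1 F2 F3 F4 F5 e K : 0 <= e -> opb F5 e ->
  \avg_x (cor F1 x ^+ 2) <= K -> \avg_x (cor F2 x ^+ 2) <= K ->
  \avg_x (cor F3 x ^+ 2) <= K -> \avg_x (cor F4 x ^+ 2) <= K ->
  `|lam F1 F2 F3 F4 F5| <= e * K.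
Proof.
move=> e0 h5 h1 h2 h3 h4.
pose P (F F' : G -> R) (z : G) : R := \avg_a (F a * F' (- z - a)).
have hP F F' : \avg_x (cor F x ^+ 2) <= K -> \avg_x (cor F' x ^+ 2) <= K ->
    \avg_z (P F F' z ^+ 2) <= K.
  move=> hF hF'; rewrite (avg_opp (fun z => (\avg_a (F a * F' (z - a))) ^+ 2)).
  exact: avg_conv_le.
have -> : lam F1 F2 F3 F4 F5 =
    \avg_z \avg_w (P F1 F2 z * P F3 F4 w * F5 (z + w)).
  transitivity (\avg_a \avg_z \avg_c \avg_w
     (F1 a * F2 (- z - a) * (F3 c * F4 (- w - c)) * F5 (z + w))).
    apply: eq_avg => a; rewrite -[LHS](avg_subl (- a)).
    apply: eq_avg => z; apply: eq_avg => c.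
    rewrite -[LHS](avg_subl (- c)); apply: eq_avg => w.
    have -> : - (a + (- a - z) + c + (- c - w)) = z + w.
      by rewrite addNKr -addrA addNKr -opprD opprK.
    by rewrite [- z - a]addrC [- w - c]addrC; ring.
  rewrite exchange_avg; apply: eq_avg => z.
  transitivity (\avg_a (F1 a * F2 (- z - a) * \avg_w (P F3 F4 w * F5 (z + w)))).
    apply: eq_avg => a; rewrite exchange_avg -avgZ; apply: eq_avg => w.
    by rewrite -avgZr -avgZ; apply: eq_avg => c; ring.
  by rewrite avgZr -avgZ; apply: eq_avg => w; rewrite mulrA.
apply: le_trans (h5 _ _) _; rewrite ler_wpM2l //.
have := hP _ _ h1 h2; have := hP _ _ h3 h4; lra.
Qed.

Lemma lam_sub F1 F2 F3 F4 F5 F5' :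
  lam F1 F2 F3 F4 F5 - lam F1 F2 F3 F4 F5' = lam F1 F2 F3 F4 (fun x => F5 x - F5' x).
Proof.
rewrite /lam -avgB; apply: eq_avg => a; rewrite -avgB; apply: eq_avg => b.
rewrite -avgB; apply: eq_avg => c; rewrite -avgB; apply: eq_avg => d; ring.
Qed.

(** Telescoping: the functions are replaced one at a time. The symmetry of [lam] rotates the current
    one into the last place, where [lam_le] applies. *)
Lemma lam_stability (F F' : nat -> G -> R) e K : 0 <= e ->
  (forall i, \avg_x (cor (F i) x ^+ 2) <= K) ->
  (forall i, \avg_x (cor (F' i) x ^+ 2) <= K) ->
  (forall i, opb (fun x => F i x - F' i x) e) ->
  `|lam (F 0%N) (F 1%N) (F 2%N) (F 3%N) (F 4%N) -
    lam (F' 0%N) (F' 1%N) (F' 2%N) (F' 3%N) (F' 4%N)| <= 5 * (e * K).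
Proof.
move=> e0 hF hF' hq.
have r A1 A2 A3 A4 A5 : lam A1 A2 A3 A4 A5 = lam A5 A1 A2 A3 A4.
  by rewrite lam_swap45 lam_swap34 lam_swap23 lam_swap12.
have st A1 A2 A3 A4 i : \avg_x (cor A1 x ^+ 2) <= K ->
   \avg_x (cor A2 x ^+ 2) <= K -> \avg_x (cor A3 x ^+ 2) <= K ->
   \avg_x (cor A4 x ^+ 2) <= K ->
   `|lam A1 A2 A3 A4 (F i) - lam (F' i) A1 A2 A3 A4| <= e * K.
  by move=> *; rewrite -(r A1 A2 A3 A4 (F' i)) lam_sub; apply: lam_le.
have := st _ _ _ _ 4%N (hF 0%N) (hF 1%N) (hF 2%N) (hF 3%N).
have := st _ _ _ _ 3%N (hF' 4%N) (hF 0%N) (hF 1%N) (hF 2%N).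
have := st _ _ _ _ 2%N (hF' 3%N) (hF' 4%N) (hF 0%N) (hF 1%N).
have := st _ _ _ _ 1%N (hF' 2%N) (hF' 3%N) (hF' 4%N) (hF 0%N).
have := st _ _ _ _ 0%N (hF' 1%N) (hF' 2%N) (hF' 3%N) (hF' 4%N).
rewrite !ler_norml => /andP[a1 b1] /andP[a2 b2] /andP[a3 b3] /andP[a4 b4] /andP[a5 b5].
by apply/andP; split; lra.
Qed.

End Averages.

(** * The smoothed count of solutions *)

(** The sampling is applied to [cor f], whose second moment is bounded by [K]. The number [k] of
    samples makes [64 * (8 * K / k)] at most [e ^+ 8], and the resulting density depends on [K] and
    [e] alone. *)
Lemma almost_periods (R : archiRealFieldType) (K e : R) : 1 <= K -> 0 < e ->
  exists2 c : R, 0 < c & forall (G : finZmodType) (f : G -> R),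
    (forall x, 0 <= f x) -> avg f = 1 -> \avg_x (cor f x ^+ 2) <= K ->
    exists2 T : {set G}, c * #|G|%:R <= #|T|%:R &
      forall t, t \in T -> opb (fun x => f (x + t) - f x) e.
Proof.
move=> K1 e0; have e8 : 0 < e ^+ 8 by rewrite exprn_gt0.
have K0 : 0 < K by apply: lt_le_trans K1.
pose k := (Num.bound (512 * K / e ^+ 8)).+1.
have hk : 512 * K / e ^+ 8 <= k%:R.
  apply: ltW; apply: lt_le_trans (archi_boundP _) _; last by rewrite ler_nat.
  by rewrite divr_ge0 ?ltW // mulr_gt0.
exists (4 * K ^+ k)^-1; first by rewrite invr_gt0 mulr_gt0 // exprn_gt0.
move=> G f f0 f1 hf.
have [|||//|T cT hT] := many_almost_periods (h := cor f) (K := K) (k := k).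
- by move=> x; apply: avg_ge0 => y; rewrite mulr_ge0.
- by rewrite avg_cor f1 expr1n.
- by [].
exists T => // t /hT ht; apply: opb_difference; first exact: ltW.
apply: le_trans (ler_wpM2l _ ht) _; first by [].
move: hk; rewrite ler_pdivrMr // => hk.
by rewrite mulrA ler_pdivrMr ?ltr0n //; lra.
Qed.

Section UniformDensity.
Variables (R : realFieldType) (G : finZmodType) (T : {set G}) (c : R).
Hypotheses (c_gt0 : 0 < c) (hT : c * #|G|%:R <= #|T|%:R).

Definition unif (t : G) : R := #|G|%:R / #|T|%:R * (t \in T)%:R.

Lemma unif_ge0 t : 0 <= unif t.
Proof. by rewrite mulr_ge0 ?divr_ge0. Qed.

Lemma unif_neq0 t : unif t != 0 -> t \in T.
Proof. by rewrite /unif; case: (t \in T); rewrite ?mulr0 ?eqxx. Qed.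

Lemma avg_mem : avg (fun t : G => (t \in T)%:R : R) = #|T|%:R / #|G|%:R.
Proof.
rewrite /avg mulrC -natr_sum; congr (_%:R / _).
by rewrite -sum1_card [in RHS]big_mkcond; apply: eq_bigr => t _; case: (t \in T).
Qed.

Lemma le_avg_mem : c <= avg (fun t : G => (t \in T)%:R : R).
Proof. by rewrite avg_mem ler_pdivlMr ?card_gt0R. Qed.

Lemma T_gt0 : 0 < #|T|%:R :> R.
Proof. by apply: lt_le_trans hT; rewrite mulr_gt0 ?card_gt0R. Qed.

Lemma avg_unif : avg unif = 1.
Proof.
rewrite /unif avgZ avg_mem; field.
by rewrite gt_eqF ?card_gt0R // gt_eqF ?T_gt0.
Qed.

Lemma avg_unif_sqr : \avg_t (unif t ^+ 2) <= c^-1.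
Proof.
have -> : \avg_t (unif t ^+ 2) = #|G|%:R / #|T|%:R.
  transitivity (#|G|%:R / #|T|%:R * avg unif); last by rewrite avg_unif mulr1.
  rewrite -avgZ; apply: eq_avg => t.
  by rewrite /unif; case: (t \in T) => /=; ring.
by rewrite ler_pdivrMr ?T_gt0 // ler_pdivlMl.
Qed.
End UniformDensity.

(** * Lower bounds for the mean of a product of five translates *)

Section LowerBound.
Variable R : realFieldType.

(** The quadratic in [u] is nonpositive for [u <= 1/2] and, after division by [B ^+ 2], never
    exceeds 1. For [u >= 1/2], either all [vi] are at least 1/4, or some [vi] is at distance at
    least 1/4 from [u] and the penalty makes the left side nonpositive. A quadratic is chosen
    because its mean is determined by the first two moments. *)
Lemma prod_lower (B u v1 v2 v3 v4 : R) : 1 <= B -> 0 <= u ->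
  0 <= v1 -> 0 <= v2 -> 0 <= v3 -> 0 <= v4 ->
  4^-1 ^+ 5 * ((u - 2^-1) * (2 * B - u) / B ^+ 2 -
   16 * ((v1 - u) ^+ 2 + (v2 - u) ^+ 2 + (v3 - u) ^+ 2 + (v4 - u) ^+ 2)) <=
  u * (v1 * v2 * v3 * v4).
Proof.
move=> B1 u0 h1 h2 h3 h4.
have B2 : 0 < B ^+ 2 by rewrite exprn_gt0 // (lt_le_trans _ B1).
set E := _ / _; set W := _ + _ + _ + _.
have P0 : 0 <= u * (v1 * v2 * v3 * v4) by rewrite !mulr_ge0.
have c5 : 0 < 4^-1 ^+ 5 :> R by rewrite exprn_gt0 // invr_gt0.
have neg : E - 16 * W <= 0 ->
    4^-1 ^+ 5 * (E - 16 * W) <= u * (v1 * v2 * v3 * v4).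
  by move=> H; apply: le_trans P0; rewrite pmulr_rle0.
have W0 : 0 <= W by rewrite !addr_ge0 ?sqr_ge0.
have E1 : E <= 1.
  rewrite ler_pdivrMr // mul1r.
  have := sqr_ge0 (2 * u - 2 * B - 2^-1); rewrite !expr2; nra.
have [hu|hu] := ltP u 2^-1.
  apply: neg; have : E <= 0 by rewrite pmulr_lle0 ?invr_gt0 // mulr_le0_ge0; lra.
  lra.
have far v : 0 <= v -> (v - u) ^+ 2 <= W -> 4^-1 <= v \/ 1 <= 16 * W.
  move=> v0 vW; have [hv|hv] := leP 4^-1 v; [by left|right].
  apply: le_trans (_ : 16 * (v - u) ^+ 2 <= _); first by nra.
  by rewrite ler_pM2l.
have s1 := sqr_ge0 (v1 - u); have s2 := sqr_ge0 (v2 - u).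
have s3 := sqr_ge0 (v3 - u); have s4 := sqr_ge0 (v4 - u).
have [|k1|k] := far v1 h1; first by rewrite /W; lra.
  2: by apply: neg; lra.
have [|k2|k] := far v2 h2; first by rewrite /W; lra.
  2: by apply: neg; lra.
have [|k3|k] := far v3 h3; first by rewrite /W; lra.
  2: by apply: neg; lra.
have [|k4|k] := far v4 h4; first by rewrite /W; lra.
  2: by apply: neg; lra.
apply: (@le_trans _ _ (4^-1 ^+ 5 * 1)); first by rewrite ler_pM2l //; lra.
rewrite mulr1 (_ : 4^-1 ^+ 5 = 4^-1 * (4^-1 * 4^-1 * 4^-1 * 4^-1)); last by ring.
have q : 0 <= 4^-1 :> R by rewrite invr_ge0.
by rewrite !ler_pM ?mulr_ge0 //; lra.
Qed.

Lemma avg_prod_lower (G : finZmodType) (u : G -> R) (B eta : R) t1 t2 t3 t4 :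
  1 <= B -> (forall x, 0 <= u x) -> avg u = 1 -> \avg_x (u x ^+ 2) <= B ->
  (forall t, t \in [:: t1; t2; t3; t4] -> \avg_x ((u (x + t) - u x) ^+ 2) <= eta) ->
  4^-1 ^+ 5 * ((2 * B ^+ 2)^-1 - 64 * eta) <=
  \avg_x (u x * (u (x + t1) * u (x + t2) * u (x + t3) * u (x + t4))).
Proof.
move=> B1 u0 u1 uB ht.
have B2 : 0 < B ^+ 2 by rewrite exprn_gt0 // (lt_le_trans _ B1).
pose W x := (u (x + t1) - u x) ^+ 2 + (u (x + t2) - u x) ^+ 2 +
  (u (x + t3) - u x) ^+ 2 + (u (x + t4) - u x) ^+ 2.
apply: (@le_trans _ _ (\avg_x (4^-1 ^+ 5 *
    ((u x - 2^-1) * (2 * B - u x) / B ^+ 2 - 16 * W x)))); last first.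
  by apply: le_avg => x; apply: prod_lower.
rewrite avgZ ler_wpM2l ?exprn_ge0 ?invr_ge0 // avgB avgZ avgZr lerD //.
  (* Mean 1 and mean square at most [B] make this mean at least 1/2. *)
  have -> : \avg_x ((u x - 2^-1) * (2 * B - u x)) =
      \avg_x ((2 * B + 2^-1) * u x + (- B - u x ^+ 2)).
    by apply: eq_avg => x; field.
  rewrite avgD avgB avgZ u1 avg_cst.
  by rewrite invfM ler_pM2r ?invr_gt0 //; lra.
rewrite lerN2 /W !avgD.
have := ht t1; have := ht t2; have := ht t3; have := ht t4.
rewrite !inE !eqxx !orbT => /(_ isT) a /(_ isT) b /(_ isT) c /(_ isT) d; lra.
Qed.
End LowerBound.

(** * Dilations and the equation with coefficients *)

Section Equation.
Variables (R : realFieldType) (G : finComUnitRingType).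
Variables n1 n2 n3 n4 : nat.
Local Notation n := (n1 + n2 + n3 + n4)%N.
Local Notation a1 := (n1%:R : G).
Local Notation a2 := (n2%:R : G).
Local Notation a3 := (n3%:R : G).
Local Notation a4 := (n4%:R : G).
Local Notation s := (n%:R : G).

Definition units_of := [/\ a1 \is a GRing.unit, a2 \is a GRing.unit,
  a3 \is a GRing.unit, a4 \is a GRing.unit & s \is a GRing.unit].

Lemma avg_mull (a : G) (f : G -> R) : a \is a GRing.unit ->
  \avg_x f (a * x) = avg f.
Proof. by move=> ua; apply: (reindex_avg f (mulrI ua)). Qed.

Lemma cor_mull (a : G) (f : G -> R) d : a \is a GRing.unit ->
  cor (fun x => f (a * x)) d = cor f (a * d).
Proof.
move=> ua; rewrite /cor -[RHS](avg_mull _ ua).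
by apply: eq_avg => x; rewrite mulrDr.
Qed.

Lemma opb_mull (a : G) q (e : R) : a \is a GRing.unit -> opb q e ->
  opb (fun x => q (a * x)) e.
Proof.
move=> ua hq u v.
have := hq (fun x => u (a^-1 * x)) (fun x => v (a^-1 * x)).
have ub : a^-1 \is a GRing.unit by rewrite unitrV.
rewrite (avg_mull (fun x => u x ^+ 2) ub) (avg_mull (fun x => v x ^+ 2) ub).
congr (`|_| <= _); rewrite -[LHS](avg_mull _ ua); apply: eq_avg => x.
rewrite -[LHS](avg_mull _ ua); apply: eq_avg => y.
by rewrite !mulKr // mulrDr.
Qed.

(* Dilating [f] by the inverse coefficients turns the equation
   [n1 x + n2 y + n3 z + n4 w = n v] into the equation counted by [lam]. *)
Definition coefs : seq G := [:: a1^-1; a2^-1; a3^-1; a4^-1; - s^-1].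
Definition dil (f : G -> R) i x := f (nth 1 coefs i * x).
Definition lamc f := lam (dil f 0) (dil f 1) (dil f 2) (dil f 3) (dil f 4).

Hypothesis hu : units_of.

Lemma coefs_unit i : nth 1 coefs i \is a GRing.unit.
Proof.
by case: hu => *; move: i => [|[|[|[|[|i]]]]] /=; rewrite ?unitrN ?unitrV ?nth_nil ?unitr1.
Qed.

Lemma cor_dil f i : \avg_x (cor (dil f i) x ^+ 2) = \avg_x (cor f x ^+ 2).
Proof.
rewrite -[RHS](avg_mull _ (coefs_unit i)); apply: eq_avg => x.
by rewrite /dil cor_mull ?coefs_unit.
Qed.

Lemma lamc_stability f g e K : 0 <= e ->
  \avg_x (cor f x ^+ 2) <= K -> \avg_x (cor g x ^+ 2) <= K ->
  opb (fun x => f x - g x) e -> `|lamc f - lamc g| <= 5 * (e * K).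
Proof.
move=> e0 hf hg hq; apply: (@lam_stability _ _ (dil f) (dil g)) => // i.
- by rewrite cor_dil.
- by rewrite cor_dil.
- by apply: (opb_mull (coefs_unit i) hq).
Qed.

Lemma lamc_solutions f : lamc f = \avg_x \avg_y \avg_z \avg_w
  (f x * f y * f z * f w * f (s^-1 * (a1 * x + a2 * y + a3 * z + a4 * w))).
Proof.
case: hu => u1 u2 u3 u4 us; rewrite /lamc /lam /dil /=.
rewrite -[LHS](avg_mull _ u1); apply: eq_avg => x.
rewrite -[LHS](avg_mull _ u2); apply: eq_avg => y.
rewrite -[LHS](avg_mull _ u3); apply: eq_avg => z.
rewrite -[LHS](avg_mull _ u4); apply: eq_avg => w.
by rewrite !mulKr // mulrNN.
Qed.

(** A solution is given by its fifth variable [x] and three displacements; the displacement of the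
    first variable balances the other three. All of them are combinations of [r], [q], [p] with
    total coefficient at most [n], so they remain almost periods when [r], [q], [p] are. *)
Lemma lamc_param f : lamc f = \avg_r \avg_q \avg_p \avg_x
  (f x * (f (x + (r *+ n2 + q *+ n3 + p *+ n4)) * f (x - r *+ n1) *
    f (x - q *+ n1) * f (x - p *+ n1))).
Proof.
case: hu => u1 u2 u3 u4 us; rewrite lamc_solutions.
have e x (F : G -> R) : \avg_y F y = \avg_r F (x - a1 * r).
  by rewrite -[LHS](avg_subl x) -[LHS](avg_mull _ u1).
transitivity (\avg_y \avg_z \avg_w \avg_x (f (a1^-1 * (s * x - a2 * y - a3 * z - a4 * w))
    * f y * f z * f w * f x)).
  rewrite exchange_avg; apply: eq_avg => y; rewrite exchange_avg; apply: eq_avg => z.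
  rewrite exchange_avg; apply: eq_avg => w.
  have ua : a1^-1 * s \is a GRing.unit by rewrite unitrM unitrV u1.
  rewrite -[LHS](avg_subr (a1^-1 * (a2 * y + a3 * z + a4 * w))) -[LHS](avg_mull _ ua).
  apply: eq_avg => x.
  have -> : a1^-1 * s * x - a1^-1 * (a2 * y + a3 * z + a4 * w) =
      a1^-1 * (s * x - a2 * y - a3 * z - a4 * w) by set b := a1^-1; ring.
  rewrite mulVKr // (_ : _ + a2 * y + a3 * z + a4 * w = s * x) ?mulKr //; ring.
transitivity (\avg_x \avg_y \avg_z \avg_w (f (a1^-1 * (s * x - a2 * y - a3 * z - a4 * w))
    * f y * f z * f w * f x)).
  rewrite [RHS]exchange_avg; apply: eq_avg => y.
  rewrite [RHS]exchange_avg; apply: eq_avg => z.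
  by rewrite [RHS]exchange_avg; apply: eq_avg => w.
transitivity (\avg_x \avg_r \avg_q \avg_p (f x * (f (x + (r *+ n2 + q *+ n3 + p *+ n4))
  * f (x - r *+ n1) * f (x - q *+ n1) * f (x - p *+ n1)))).
  apply: eq_avg => x; rewrite [LHS](e x); apply: eq_avg => r.
  rewrite [LHS](e x); apply: eq_avg => q; rewrite [LHS](e x); apply: eq_avg => p.
  rewrite -(mulr_natl r n2) -(mulr_natl q n3) -(mulr_natl p n4) -(mulr_natl r n1)
    -(mulr_natl q n1) -(mulr_natl p n1) (_ : s * x - _ - _ - _ = a1 * (x + (a2 * r + a3 * q + a4 * p))).
    by rewrite mulKr //; ring.
  by rewrite !natrD; ring.
rewrite exchange_avg; apply: eq_avg => r; rewrite exchange_avg; apply: eq_avg => q.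
by rewrite exchange_avg.
Qed.

(* The smoothing [sm2 gam f] is nearly invariant under the almost periods [T] of
   [f]; hence so is [u], and [u] is bounded below along most of the solutions
   that [lamc_param] builds from three elements of [T]. *)
Lemma lamc_lower f u gam (T : {set G}) (B M c e tau : R) :
  1 <= B -> (forall x, 0 <= u x) -> avg u = 1 -> \avg_x (u x ^+ 2) <= B ->
  (forall t, 0 <= gam t) -> avg gam = 1 -> \avg_t (gam t ^+ 2) <= M ->
  \avg_x ((u x - sm2 gam f x) ^+ 2) <= tau -> 0 < c ->
  c * #|G|%:R <= #|T|%:R -> 0 < e -> 0 <= tau ->
  (forall t, t \in T -> opb (fun x => f (x + t) - f x) e) ->
  (n%:R * e) ^+ 2 * M <= tau -> 576 * tau <= (4 * B ^+ 2)^-1 ->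
  c ^+ 3 * (4^-1 ^+ 5 * (4 * B ^+ 2)^-1) <= lamc u.
Proof.
case: hu => u1' u2' u3' u4' us B1 u0 u1 uB g0 g1 gM hug c0 hT e0 tau0 hTe hM htau.
have n0 : (0 < n)%N.
  by rewrite lt0n; apply: contraTneq us => ->; rewrite unitr0.
have nR : 0 < n%:R :> R by rewrite ltr0n.
have ne0 : 0 < n%:R * e by rewrite mulr_gt0.
pose g := sm2 gam f.
(* Three errors of mean square at most [tau] add up: two for passing between [u] and [g], one for
   translating [g]. The square of a sum of three terms is at most three times the sum of the
   squares. *)
have near t m : (m <= n)%N -> opb (fun x => f (x + t) - f x) (e *+ m) ->
    \avg_x ((u (x + t) - u x) ^+ 2) <= 9 * tau.
  move=> mn ht.
  have hg : \avg_x ((g (x + t) - g x) ^+ 2) <= tau.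
    apply: le_trans hM; apply: le_trans (ler_wpM2l (sqr_ge0 _) gM).
    have ht' : opb (fun x => f (x + t) - f x) (n%:R * e).
      by apply: opb_le ht; rewrite -(mulr_natl e m) ler_pM2r // ler_nat.
    apply: le_trans (opb_smo_norm gam ne0 (opb_smon g0 g1 ht')).
    rewrite le_eqVlt; apply/orP; left; apply/eqP; apply: eq_avg => x; congr (_ ^+ 2).
    rewrite /g /sm2 /smo -avgB; apply: eq_avg => y; rewrite -mulrBr; congr (_ * _).
    rewrite /smon -avgB; apply: eq_avg => z; rewrite -mulrBr; congr (_ * (f _ - _)).
    by rewrite [x + t + y]addrAC; apply: addrAC.
  have hug' : \avg_x ((u (x + t) - g (x + t)) ^+ 2) <= tau.
    by rewrite (avg_addr t (fun x => (u x - g x) ^+ 2)).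
  apply: (@le_trans _ _ (\avg_x (3 * (u (x + t) - g (x + t)) ^+ 2 +
     (3 * (g (x + t) - g x) ^+ 2 + 3 * (u x - g x) ^+ 2)))).
    apply: le_avg => x; set A := u (x + t); set C := g (x + t).
    have := sqr_ge0 ((A - C) - (C - g x)).
    have := sqr_ge0 ((A - C) + (u x - g x)).
    have := sqr_ge0 ((C - g x) + (u x - g x)); lra.
  rewrite !avgD !avgZ; move: hug; rewrite -/g; lra.
have e0' := ltW e0.
pose kap : R := 4^-1 ^+ 5 * (4 * B ^+ 2)^-1.
have kap0 : 0 <= kap.
  by rewrite mulr_ge0 ?exprn_ge0 ?invr_ge0 ?mulr_ge0 ?exprn_ge0 // (le_trans _ B1).
have key r q p : r \in T -> q \in T -> p \in T -> kap <=
  \avg_x (u x * (u (x + (r *+ n2 + q *+ n3 + p *+ n4)) * u (x - r *+ n1) *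
    u (x - q *+ n1) * u (x - p *+ n1))).
  move=> hr hq hp.
  have tM t m : t \in T -> opb (fun x => f (x + t *+ m) - f x) (e *+ m).
    by move=> tT; apply: opb_trM => //; apply: hTe.
  have tN t : t \in T -> \avg_x ((u (x - t *+ n1) - u x) ^+ 2) <= 9 * tau.
    move=> tT; apply: (near _ n1); first by rewrite -!addnA leq_addr.
    exact/opb_trN/tM.
  apply: le_trans (avg_prod_lower (eta := 9 * tau) B1 u0 u1 uB _).
    rewrite ler_pM2l ?exprn_gt0 ?invr_gt0 //.
    have -> : (2 * B ^+ 2)^-1 = 2 * (4 * B ^+ 2)^-1.
      by field; rewrite gt_eqF // (lt_le_trans _ B1).
    lra.
  move=> t; rewrite !inE => /or4P[] /eqP ->; try exact: tN.
  apply: (near _ (n2 + n3 + n4)%N); first by rewrite -!addnA leq_addl.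
  by rewrite !mulrnDr; do 2?apply: opb_trD; apply: tM.
pose I t : R := (t \in T)%:R.
have cI := le_avg_mem hT; have c0' := ltW c0.
rewrite lamc_param.
(* Restricting the three displacements to [T] keeps a proportion at least [c ^+ 3] of them. *)
apply: (@le_trans _ _ (\avg_r \avg_q \avg_p (I r * (I q * (I p * kap))))).
  rewrite (@eq_avg _ _ _ (fun r => I r * (avg I * (avg I * kap)))); last first.
    move=> r; rewrite -avgZr -avgZ; apply: eq_avg => q.
    by rewrite -avgZr -!avgZ.
  rewrite avgZr -/kap (_ : c ^+ 3 * kap = c * (c * (c * kap))); last by ring.
  have h1 : c * kap <= avg I * kap by rewrite ler_wpM2r.
  have h2 : c * (c * kap) <= avg I * (avg I * kap) by apply: ler_pM => //; apply: mulr_ge0.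
  by apply: ler_pM => //; do 2?apply: mulr_ge0.
apply: le_avg => r; apply: le_avg => q; apply: le_avg => p.
have P0 : 0 <= \avg_x (u x * (u (x + (r *+ n2 + q *+ n3 + p *+ n4)) * u (x - r *+ n1)
    * u (x - q *+ n1) * u (x - p *+ n1))).
  by apply: avg_ge0 => x; rewrite !mulr_ge0.
rewrite /I; case rT: (r \in T); rewrite ?mul0r ?mul1r //.
case qT: (q \in T); rewrite ?mul0r ?mul1r //.
by case pT: (p \in T); rewrite ?mul0r ?mul1r //; apply: key.
Qed.

End Equation.

(** * Iteration of the energy increment *)

Section MainCount.
Variables (R : archiRealFieldType) (n1 n2 n3 n4 : nat) (D : R).
Hypothesis D_ge1 : 1 <= D.
Local Notation n := (n1 + n2 + n3 + n4)%N.

(** [L] measures the spike of the autocorrelation at 0; for the normalised indicator of a Sidon set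
    it is the inverse of the number of elements. *)
Definition pseudorandom (G : finZmodType) (f : G -> R) (L : R) :=
  [/\ forall x, 0 <= f x, avg f = 1,
      forall d, cor f d <= D + L * (#|G|%:R * (d == 0)%:R) &
      \avg_x (cor f x ^+ 2) <= 2 * D].

(** [B] bounds the energy of every smoothing by a density of second moment at most [M] once
    [L * M <= 1]; [tau] is chosen so that [576 * tau] is exactly the bound required by
    [lamc_lower]. *)
Let B : R := D + 1.
Let tau : R := (2304 * B ^+ 2)^-1.

(** Each round either raises the energy of a smoothing by [tau / 2], or finds two successive
    smoothings close in L^2. In the latter case [lamc_lower] bounds the count for the new one, and
    stability transfers the bound to [f]. The constants are uniform over all groups. *)
Lemma dichotomy j : exists M lambda : R, [/\ 0 < M, 0 < lambda &
  forall (G : finComUnitRingType) (f : G -> R) (L : R), units_of G n1 n2 n3 n4 ->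
    pseudorandom f L -> 0 <= L -> L * M <= 1 ->
    lambda <= lamc n1 n2 n3 n4 f \/
    exists gam : G -> R, [/\ forall t, 0 <= gam t, avg gam = 1,
      \avg_t (gam t ^+ 2) <= M & j%:R * (tau / 2) <= \avg_x (sm2 gam f x ^+ 2)]].
Proof.
have D1 := D_ge1; have B1 : 1 <= B by rewrite /B; lra.
have B2 : 1 <= B ^+ 2 by rewrite exprn_ege1.
have tau0 : 0 < tau by rewrite invr_gt0; lra.
have tau1 : tau <= 1 by rewrite invf_le1; lra.
have taue : 576 * tau = (4 * B ^+ 2)^-1.
  by rewrite /tau; field; rewrite gt_eqF //; lra.
elim: j => [|j [M [lambda [M0 l0 IH]]]].
  exists 1, 1; split=> // G f L _ _ _ _; right; exists (fun=> 1); split=> //.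
  - exact: avg_cst.
  - by rewrite avg_cst expr1n.
  - by rewrite mul0r avg_ge0 // => x; rewrite sqr_ge0.
pose kap : R := 4^-1 ^+ 5 * (4 * B ^+ 2)^-1.
have kap0 : 0 < kap by rewrite mulr_gt0 ?exprn_gt0 ?invr_gt0 //; lra.
have n0 : 0 <= n%:R :> R by [].
have nM0 : 0 < (n%:R + 1) * (M + 1) by rewrite mulr_gt0; lra.
(* The precision of the almost periods that will produce solutions, fine enough compared with [M] to
   leave the previous smoothing nearly invariant. *)
pose e1 : R := tau / ((n%:R + 1) * (M + 1)).
have e10 : 0 < e1 by rewrite divr_gt0.
have he1 : (n%:R * e1) ^+ 2 * M <= tau.
  have M1 : 0 < M + 1 by lra.
  have h : n%:R * e1 <= tau / (M + 1).
    have -> : e1 = tau / (M + 1) / (n%:R + 1).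
      by rewrite /e1; field; rewrite !gt_eqF //; lra.
    rewrite mulrA ler_pdivrMr; last by lra.
    have : 0 <= tau / (M + 1) by rewrite divr_ge0 ?ltW.
    move: (_ / _) => z z0; nra.
  apply: (@le_trans _ _ ((tau / (M + 1)) ^+ 2 * M)).
    rewrite ler_pM2r // lerXn2r // nnegrE; last by rewrite divr_ge0 ?ltW.
    by rewrite mulr_ge0 // ltW.
  have -> : (tau / (M + 1)) ^+ 2 * M = tau * (tau * (M / (M + 1) ^+ 2)).
    by field; rewrite gt_eqF.
  rewrite ger_pMr //; apply: mulr_ile1 => //; first exact: ltW.
    by rewrite divr_ge0 ?exprn_ge0 ?ltW.
  by rewrite ler_pdivrMr ?exprn_gt0 // expr2; nra.
have D2 : 1 <= 2 * D by lra.
have [c1 c10 hc1] := almost_periods D2 e10.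
pose l1 : R := c1 ^+ 3 * kap.
have l10 : 0 < l1 by rewrite mulr_gt0 // exprn_gt0.
(* The first bound keeps the change of the count, [5 * (2 * e2) * (2 * D)], at most [l1 / 2]; the
   second keeps the error term of [energy_increment] at most [tau / 2]. *)
pose e2 : R := Num.min (l1 / (40 * D)) (tau / (4 * (B + M))).
have BM0 : 0 < B + M by lra.
have e20 : 0 < e2 by rewrite lt_min !divr_gt0 //; lra.
have he2 : 40 * D * e2 <= l1.
  rewrite mulrC -ler_pdivlMr; last by lra.
  by rewrite ge_min lexx.
have he2' : 4 * (B + M) * e2 <= tau.
  rewrite mulrC -ler_pdivlMr; last by lra.
  by rewrite ge_min lexx orbT.
have [c2 c20 hc2] := almost_periods D2 e20.
exists (Num.max M c2^-1), (Num.min lambda (l1 / 2)); split.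
- by rewrite lt_max M0.
- by rewrite lt_min l0 divr_gt0.
move=> G f L hu hf L0 LM.
have LM1 : L * M <= 1.
  by apply: le_trans LM; rewrite ler_wpM2l // le_max lexx.
have LM2 : L * c2^-1 <= 1.
  by apply: le_trans LM; rewrite ler_wpM2l // le_max lexx orbT.
have [hl|[gam [g0 g1 gM gE]]] := IH G f L hu hf L0 LM1.
  by left; rewrite ge_min hl.
have [f0 f1 fc fK] := hf.
have [T1 hT1 pT1] := hc1 G f f0 f1 fK.
have [T2 hT2 pT2] := hc2 G f f0 f1 fK.
pose gam' : G -> R := unif R T2.
have g0' : forall t, 0 <= gam' t by move=> t; apply: unif_ge0.
have g1' : avg gam' = 1 by apply: avg_unif hT2.
have gM' : \avg_t (gam' t ^+ 2) <= c2^-1 by apply: avg_unif_sqr.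
have hq : opb (fun x => sm2 gam' f x - f x) (e2 + e2).
  by apply: opb_sm2 => // t /unif_neq0 /pT2.
have hB : \avg_x (smon gam f x ^+ 2) <= B.
  apply: le_trans (smon_L2 g0 g1 f0 fc) _; rewrite lerD2l.
  by apply: le_trans LM1; rewrite ler_wpM2l.
have hB' : \avg_x (sm2 gam' f x ^+ 2) <= B.
  apply: le_trans (smo_contract g0' g1' _) _.
  apply: le_trans (smon_L2 g0' g1' f0 fc) _; rewrite lerD2l.
  by apply: le_trans LM2; rewrite ler_wpM2l.
have e22 : 0 <= e2 + e2 by rewrite addr_ge0 ?ltW.
have inc := energy_increment g0 g1 e22 hq hB gM.
have [close|far] := leP (\avg_x ((sm2 gam' f x - sm2 gam f x) ^+ 2)) tau.
  left.
  have u0 x : 0 <= sm2 gam' f x by apply: smo_ge0 => // y; apply: smon_ge0.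
  have u1 : avg (sm2 gam' f) = 1 by rewrite avg_smo // avg_smon.
  have low : l1 <= lamc n1 n2 n3 n4 (sm2 gam' f).
    apply: (lamc_lower hu B1 u0 u1 hB' g0 g1 gM close c10 hT1 e10 _ pT1 he1 _).
      exact: ltW.
    by rewrite taue.
  have cK : \avg_x (cor (sm2 gam' f) x ^+ 2) <= 2 * D.
    exact: le_trans (cor_sm2_le g0' g1' f) fK.
  have := lamc_stability hu e22 cK fK hq.
  rewrite ler_norml => /andP[_ st].
  by rewrite ge_min; apply/orP; right; lra.
right; exists gam'; split=> //; first by rewrite le_max gM' orbT.
rewrite -natr1; lra.
Qed.

(** The energy of a smoothing is at most [B], so for [j > 2 * B / tau] only the first alternative of
    [dichotomy] is possible. *)
Theorem lamc_pseudorandom : exists lambda L0 : R, [/\ 0 < lambda, 0 < L0 &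
  forall (G : finComUnitRingType) (f : G -> R) (L : R), units_of G n1 n2 n3 n4 ->
    pseudorandom f L -> 0 <= L -> L <= L0 -> lambda <= lamc n1 n2 n3 n4 f].
Proof.
have D1 := D_ge1; have B1 : 1 <= B by rewrite /B; lra.
have B2 : 1 <= B ^+ 2 by rewrite exprn_ege1.
have tau0 : 0 < tau by rewrite invr_gt0; lra.
pose j := Num.bound (2 * B / tau).
have hj : 2 * B / tau < j%:R by apply: archi_boundP; rewrite divr_ge0 ?ltW //; lra.
have [M [lambda [M0 l0 H]]] := dichotomy j.
exists lambda, M^-1; split=> //; first by rewrite invr_gt0.
move=> G f L hu hf L0 LM.
have LM1 : L * M <= 1 by rewrite -ler_pdivlMr // mul1r.
case: (H G f L hu hf L0 LM1) => // -[gam [g0 g1 gM gE]].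
have [f0 f1 fc fK] := hf.
have hB : \avg_x (sm2 gam f x ^+ 2) <= B.
  apply: le_trans (smo_contract g0 g1 _) _.
  apply: le_trans (smon_L2 g0 g1 f0 fc) _; rewrite lerD2l.
  by apply: le_trans LM1; rewrite ler_wpM2l.
by move: hj; rewrite ltr_pdivrMr //; lra.
Qed.

End MainCount.

(** * Sidon sets in a finite ring *)

Lemma sum4_bounds n1 n2 n3 n4 (n := (n1 + n2 + n3 + n4)%N) :
  (0 < n1)%N -> (0 < n2)%N -> (0 < n3)%N -> (0 < n4)%N ->
  [/\ n1 < n, n2 < n, n3 < n & n4 < n]%N /\
  ([/\ n1 + n2 <= n, n1 + n3 <= n & n1 + n4 <= n] /\
   [/\ n2 + n3 <= n, n2 + n4 <= n & n3 + n4 <= n])%N.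
Proof. by rewrite /n => *; do !split; lia. Qed.

Section SidonIndicator.
Variables (R : realFieldType) (G : finComUnitRingType) (A : {set G}) (D : R).
Hypothesis sidonA : forall x y z w, x \in A -> y \in A -> z \in A -> w \in A ->
  x + y = z + w -> (x = z /\ y = w) \/ (x = w /\ y = z).
Hypotheses (A_gt0 : (0 < #|A|)%N) (D_ge1 : 1 <= D).
Hypothesis A_dense : #|G|%:R <= D * #|A|%:R ^+ 2.
Local Notation N := (#|G|%:R : R).
Local Notation m := (#|A|%:R : R).
Local Notation f := (unif R A).

Let m_gt0 : 0 < m. Proof. by rewrite ltr0n. Qed.
Let N_gt0 : 0 < N. Proof. exact: card_gt0R. Qed.

Lemma avg_unifA : avg f = 1.
Proof.
apply: (@avg_unif _ _ A (m / N)); first by rewrite divr_gt0.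
by rewrite divfK // gt_eqF.
Qed.

Lemma unifA_sqr x : f x * f x = N / m * f x.
Proof. by rewrite /unif; case: (x \in A) => /=; ring. Qed.

Lemma cor_unifA0 : cor f 0 = N / m.
Proof.
rewrite /cor -[RHS]mulr1 -[X in _ * X]avg_unifA -avgZ.
by apply: eq_avg => x; rewrite addr0 unifA_sqr.
Qed.

(** A nonzero [d] is a difference of two elements of [A] in at most one way, which gives at most
    [N / m ^+ 2]; at 0 the value is [N / m]. *)
Lemma cor_unifA d : cor f d <= D + m^-1 * (N * (d == 0)%:R).
Proof.
have ND : N / m ^+ 2 <= D by rewrite ler_pdivrMr // exprn_gt0.
have [->|d0] := eqVneq d 0.
  by rewrite cor_unifA0 mulr1 [m^-1 * N]mulrC lerDr (le_trans _ D_ge1).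
rewrite !mulr0 addr0; apply: le_trans ND.
have -> : cor f d = N / m ^+ 2 * \sum_x ((x \in A) && (x + d \in A))%:R.
  rewrite /cor /avg /unif.
  rewrite (eq_bigr (fun x => (N / m) ^+ 2 * ((x \in A) && (x + d \in A))%:R)).
    by rewrite -mulr_sumr; field; rewrite !gt_eqF.
  by move=> x _; case: (x \in A); case: (x + d \in A) => /=; ring.
rewrite ger_pMr ?divr_gt0 ?exprn_gt0 // -natr_sum lern1.
have -> : (\sum_x ((x \in A) && ((x + d)%R \in A)) =
    #|[set x | (x \in A) && ((x + d)%R \in A)]|)%N.
  by rewrite -sum1dep_card [RHS]big_mkcond; apply: eq_bigr => x _; case: (_ && _).
apply/card_le1_eqP => x y; rewrite !inE => /andP[xA xdA] /andP[yA ydA].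
have [] := sidonA xdA yA ydA xA _; first by rewrite -addrA addrC [d + y]addrC.
  by case=> _ ->.
case=> e _; case/eqP: d0; apply: (addrI x).
by rewrite addr0.
Qed.

(** One of the two factors [cor f x] is bounded by [cor_unifA]. The constant part then contributes
    [D], since [cor f] has mean 1, and the spike contributes [N / m ^+ 2]. *)
Lemma cor_unifA_L2 : \avg_x (cor f x ^+ 2) <= 2 * D.
Proof.
have c0 x : 0 <= cor f x by apply: avg_ge0 => y; rewrite mulr_ge0 // unif_ge0.
apply: (@le_trans _ _ (\avg_x (cor f x * D + m^-1 * (cor f x * (N * (x == 0)%:R))))).
  apply: le_avg => x; rewrite mulrCA -mulrDr expr2 ler_wpM2l //; exact: cor_unifA.
rewrite avgD avgZr (avgZ m^-1) avg_delta avg_cor avg_unifA expr1n mul1r cor_unifA0.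
rewrite mulr2n mulrDl !mul1r lerD2l mulrCA -invfM -expr2 ler_pdivrMr ?exprn_gt0 //.
Qed.

(** This is the four-variable equation left when two variables coincide. Its count is a scalar
    product of two convolutions, each controlled by the L^2 norm of [cor f]. *)
Lemma avg3_le (b1 b2 b3 c : G) : b1 \is a GRing.unit -> b2 \is a GRing.unit ->
  b3 \is a GRing.unit -> c \is a GRing.unit ->
  \avg_x \avg_y \avg_z (f x * f y * f z * f (c^-1 * (b1 * x + b2 * y + b3 * z)))
    <= 2 * D.
Proof.
move=> u1 u2 u3 uc.
pose F b x := f (b^-1 * x).
have hF b : b \is a GRing.unit -> \avg_x (cor (F b) x ^+ 2) <= 2 * D.
  move=> ub; have ub' : b^-1 \is a GRing.unit by rewrite unitrV.
  apply: le_trans cor_unifA_L2; rewrite -[leRHS](avg_mull _ ub').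
  by rewrite le_eqVlt; apply/orP; left; apply/eqP; apply: eq_avg => x; rewrite cor_mull.
have -> : \avg_x \avg_y \avg_z
      (f x * f y * f z * f (c^-1 * (b1 * x + b2 * y + b3 * z))) =
    \avg_z ((\avg_a (F b1 a * F b2 (z - a))) * (\avg_a (F (- b3) a * F c (z - a)))).
  transitivity (\avg_x \avg_y \avg_z (F b1 x * F b2 y * F b3 z * F c (x + y + z))).
    rewrite -[RHS](avg_mull _ u1); apply: eq_avg => x.
    rewrite -[RHS](avg_mull _ u2); apply: eq_avg => y.
    rewrite -[RHS](avg_mull _ u3); apply: eq_avg => z.
    by rewrite /F !mulKr.
  transitivity (\avg_x \avg_y \avg_z (F b1 x * F b2 (y - x) * F (- b3) z * F c (y - z))).
    apply: eq_avg => x; rewrite -[LHS](avg_addl (- x)); apply: eq_avg => y.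
    rewrite -[LHS]avg_opp; apply: eq_avg => z.
    have -> : F (- b3) z = F b3 (- z) by rewrite /F invrN mulrN mulNr.
    by rewrite addNKr [- x + y]addrC.
  rewrite exchange_avg; apply: eq_avg => z; rewrite -avgZr; apply: eq_avg => a.
  by rewrite -avgZ; apply: eq_avg => y; ring.
apply: le_trans (avg_AMGM _ _) _.
have u3' : - b3 \is a GRing.unit by rewrite unitrN.
have := avg_conv_le (hF _ u1) (hF _ u2); have := avg_conv_le (hF _ u3') (hF _ uc).
lra.
Qed.

Definition sol b1 b2 b3 b4 c x y z w : R :=
  f x * f y * f z * f w * f (c^-1 * (b1 * x + b2 * y + b3 * z + b4 * w)).

(** The diagonal has density [1 / N], whereas the square of [f y] is [N / m] times [f y]; the net
    factor is [1 / m]. *)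
Lemma avg_unifA_eq F y : \avg_x ((x == y)%:R * (f x * f y * F x)) = m^-1 * (f y * F y).
Proof.
transitivity (\avg_x (m^-1 * (f x * F x * (N * (x == y)%:R)))).
  apply: eq_avg => x; have [->|] := eqVneq x y; last by rewrite !(mulr0, mul0r).
  by rewrite /= unifA_sqr mul1r; field; rewrite gt_eqF.
by rewrite avgZ avg_delta.
Qed.

Lemma sol_eq12 b1 b2 b3 b4 c : b1 + b2 \is a GRing.unit ->
  b3 \is a GRing.unit -> b4 \is a GRing.unit -> c \is a GRing.unit ->
  \avg_x \avg_y \avg_z \avg_w ((x == y)%:R * sol b1 b2 b3 b4 c x y z w)
    <= m^-1 * (2 * D).
Proof.
move=> u12 u3 u4 uc; apply: le_trans (ler_wpM2l _ (avg3_le u12 u3 u4 uc)); last first.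
  by rewrite invr_ge0 ltW.
rewrite le_eqVlt; apply/orP; left; apply/eqP.
rewrite exchange_avg -avgZ; apply: eq_avg => y.
pose F x := \avg_z \avg_w (f z * f w * f (c^-1 * (b1 * x + b2 * y + b3 * z + b4 * w))).
transitivity (\avg_x ((x == y)%:R * (f x * f y * F x))).
  apply: eq_avg => x; rewrite /F -!avgZ; apply: eq_avg => z; rewrite -!avgZ.
  by apply: eq_avg => w; rewrite /sol; ring.
rewrite avg_unifA_eq /F; congr (_ * _); rewrite -avgZ; apply: eq_avg => z.
rewrite -avgZ; apply: eq_avg => w.
by rewrite -mulrDl; ring.
Qed.

(** When [x] is also the fifth variable, it moves to the other side with coefficient [c - b1]. *)
Lemma sol_eq15 b1 b2 b3 b4 c : c - b1 \is a GRing.unit ->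
  b2 \is a GRing.unit -> b3 \is a GRing.unit -> b4 \is a GRing.unit ->
  c \is a GRing.unit ->
  \avg_x \avg_y \avg_z \avg_w ((x == c^-1 * (b1 * x + b2 * y + b3 * z + b4 * w))%:R *
    sol b1 b2 b3 b4 c x y z w) <= m^-1 * (2 * D).
Proof.
move=> u1 u2 u3 u4 uc; apply: le_trans (ler_wpM2l _ (avg3_le u2 u3 u4 u1)); last first.
  by rewrite invr_ge0 ltW.
rewrite le_eqVlt; apply/orP; left; apply/eqP.
rewrite exchange_avg -avgZ; apply: eq_avg => y.
rewrite exchange_avg -avgZ; apply: eq_avg => z.
rewrite exchange_avg -avgZ; apply: eq_avg => w.
set v := (c - b1)^-1 * _.
transitivity (m^-1 * (f v * (f y * f z * f w))); last by ring.
rewrite -(avg_unifA_eq (fun=> f y * f z * f w)); apply: eq_avg => x.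
have -> : (x == c^-1 * (b1 * x + b2 * y + b3 * z + b4 * w)) = (x == v).
  rewrite -(can_eq (mulKr uc)) mulVKr // -[in RHS](can_eq (mulKr u1)) mulVKr //.
  by rewrite -subr_eq0 -[in RHS]subr_eq0; congr (_ == 0); ring.
have [->|_] := eqVneq x v; last by rewrite !mul0r.
rewrite /sol (_ : _ + _ = c * v) ?mulKr //; first by ring.
rewrite -!addrA (addrA (b2 * y)) -[X in _ + X](mulVKr u1) -/v; ring.
Qed.

Lemma unif_out x : x \notin A -> f x = 0.
Proof. by move=> /negPf xA; rewrite /unif xA mulr0. Qed.

(** Each of the ten possible coincidences has weight at most [2 * D / m], in total less than
    [lambda]. Identifying two variables creates coefficients [ni + nj] or [n - ni], all between 1
    and [n], whence the assumption on units. *)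
Lemma many_solutions (n1 n2 n3 n4 : nat) (n := (n1 + n2 + n3 + n4)%N) (lambda : R) :
  (0 < n1)%N -> (0 < n2)%N -> (0 < n3)%N -> (0 < n4)%N ->
  (forall k, (0 < k <= n)%N -> (k%:R : G) \is a GRing.unit) ->
  lambda <= lamc n1 n2 n3 n4 f -> 20 * D < lambda * m ->
  exists x y z w v, [/\ [/\ x \in A, y \in A, z \in A, w \in A & v \in A],
    uniq [:: x; y; z; w; v] &
    n1%:R * x + n2%:R * y + n3%:R * z + n4%:R * w = n%:R * v].
Proof.
move=> p1 p2 p3 p4 hu hl hm.
have [[b1 b2 b3 b4] [[b12 b13 b14] [b23 b24 b34]]] := sum4_bounds p1 p2 p3 p4.
have un k : (0 < k)%N -> (k <= n)%N -> (k%:R : G) \is a GRing.unit.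
  by move=> k0 kn; apply: hu; rewrite k0.
have u1 : (n1%:R : G) \is a GRing.unit by apply: un; rewrite // ltnW.
have u2 : (n2%:R : G) \is a GRing.unit by apply: un; rewrite // ltnW.
have u3 : (n3%:R : G) \is a GRing.unit by apply: un; rewrite // ltnW.
have u4 : (n4%:R : G) \is a GRing.unit by apply: un; rewrite // ltnW.
have us : (n%:R : G) \is a GRing.unit by apply: un; rewrite // (leq_trans p1) // ltnW.
pose v x y z w : G := n%:R^-1 * (n1%:R * x + n2%:R * y + n3%:R * z + n4%:R * w).
pose S x y z w : R := f x * f y * f z * f w * f (v x y z w).
case: (boolP [exists x, exists y, exists z, exists w,
   [&& x \in A, y \in A, z \in A, w \in A, v x y z w \in A &
     uniq [:: x; y; z; w; v x y z w]]]).
  case/existsP=> x /existsP[y /existsP[z /existsP[w]]].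
  case/and5P=> xA yA zA wA /andP[vA U].
  exists x, y, z, w, (v x y z w); split=> //.
  by rewrite /v mulVKr.
move=> nex.
have deg x y z w : S x y z w <= (x == y)%:R * S x y z w + (x == z)%:R * S x y z w +
   (x == w)%:R * S x y z w + (x == v x y z w)%:R * S x y z w +
   (y == z)%:R * S x y z w + (y == w)%:R * S x y z w +
   (y == v x y z w)%:R * S x y z w + (z == w)%:R * S x y z w +
   (z == v x y z w)%:R * S x y z w + (w == v x y z w)%:R * S x y z w.
  have S0 : 0 <= S x y z w.
    by rewrite /S; do 4![apply: mulr_ge0; last exact: unif_ge0]; exact: unif_ge0.
  rewrite -!mulrDl -!natrD.
  have [->|Sn] := eqVneq (S x y z w) 0; first by rewrite mulr0.
  rewrite ler_peMl // ler1n lt0n; apply: contraNneq nex => /eqP.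
  rewrite !addn_eq0 !eqb0 => h.
  have xA : x \in A.
    by apply: contraNT Sn => H; rewrite /S (unif_out H) !(mul0r, mulr0).
  have yA : y \in A.
    by apply: contraNT Sn => H; rewrite /S (unif_out H) !(mul0r, mulr0).
  have zA : z \in A.
    by apply: contraNT Sn => H; rewrite /S (unif_out H) !(mul0r, mulr0).
  have wA : w \in A.
    by apply: contraNT Sn => H; rewrite /S (unif_out H) !(mul0r, mulr0).
  have vA : v x y z w \in A.
    by apply: contraNT Sn => H; rewrite /S (unif_out H) !(mul0r, mulr0).
  apply/existsP; exists x; apply/existsP; exists y; apply/existsP; exists z.
  apply/existsP; exists w; rewrite xA yA zA wA vA /= !inE !negb_or.
  by move: h; do ![case: (_ == _) => //=].
pose T (F : G -> G -> G -> G -> R) : R := \avg_x \avg_y \avg_z \avg_w F x y z w.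
have lS : lamc n1 n2 n3 n4 f = T S by rewrite lamc_solutions //; split.
have TD F F' : T (fun x y z w => F x y z w + F' x y z w) = T F + T F'.
  rewrite /T -avgD; apply: eq_avg => x; rewrite -avgD; apply: eq_avg => y.
  by rewrite -avgD; apply: eq_avg => z; rewrite avgD.
have eqT F F' : (forall x y z w, F x y z w = F' x y z w) -> T F = T F'.
  move=> E; apply: eq_avg => x; apply: eq_avg => y; apply: eq_avg => z.
  by apply: eq_avg => w.
(* Permuting the variables reduces each coincidence to [sol_eq12] or [sol_eq15]. *)
have sw12 F : T F = T (fun x y z w => F y x z w) by rewrite /T exchange_avg.
have sw23 F : T F = T (fun x y z w => F x z y w).
  by rewrite /T; apply: eq_avg => x; rewrite exchange_avg.
have sw34 F : T F = T (fun x y z w => F x y w z).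
  by rewrite /T; apply: eq_avg => x; apply: eq_avg => y; rewrite exchange_avg.
have uD i j : (0 < i)%N -> (i + j <= n)%N -> (i%:R + j%:R : G) \is a GRing.unit.
  by move=> i0 ij; rewrite -natrD un // addn_gt0 i0.
have uB i : (i < n)%N -> (n%:R - i%:R : G) \is a GRing.unit.
  by move=> i_n; rewrite -natrB ?un ?subn_gt0 ?leq_subr // ltnW.
set K' := m^-1 * (2 * D).
have P12 : T (fun x y z w => (x == y)%:R * S x y z w) <= K'.
  by apply: sol_eq12 => //; apply: uD.
have P13 : T (fun x y z w => (x == z)%:R * S x y z w) <= K'.
  rewrite sw23 (eqT _ (fun x y z w => (x == y)%:R *
     sol n1%:R n3%:R n2%:R n4%:R n%:R x y z w)).
    by apply: sol_eq12 => //; apply: uD.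
  by move=> x y z w; rewrite /S /sol; congr (_ * (_ * f (_ * _))); ring.
have P14 : T (fun x y z w => (x == w)%:R * S x y z w) <= K'.
  rewrite sw34 sw23 (eqT _ (fun x y z w => (x == y)%:R *
     sol n1%:R n4%:R n2%:R n3%:R n%:R x y z w)).
    by apply: sol_eq12 => //; apply: uD.
  by move=> x y z w; rewrite /S /sol; congr (_ * (_ * f (_ * _))); ring.
have P23 : T (fun x y z w => (y == z)%:R * S x y z w) <= K'.
  rewrite sw12 sw23 (eqT _ (fun x y z w => (x == y)%:R *
     sol n2%:R n3%:R n1%:R n4%:R n%:R x y z w)).
    by apply: sol_eq12 => //; apply: uD.
  by move=> x y z w; rewrite /S /sol; congr (_ * (_ * f (_ * _))); ring.
have P24 : T (fun x y z w => (y == w)%:R * S x y z w) <= K'.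
  rewrite sw12 sw34 sw23 (eqT _ (fun x y z w => (x == y)%:R *
     sol n2%:R n4%:R n1%:R n3%:R n%:R x y z w)).
    by apply: sol_eq12 => //; apply: uD.
  by move=> x y z w; rewrite /S /sol; congr (_ * (_ * f (_ * _))); ring.
have P34 : T (fun x y z w => (z == w)%:R * S x y z w) <= K'.
  rewrite sw23 sw12 sw34 sw23 (eqT _ (fun x y z w => (x == y)%:R *
     sol n3%:R n4%:R n1%:R n2%:R n%:R x y z w)).
    by apply: sol_eq12 => //; apply: uD.
  by move=> x y z w; rewrite /S /sol; congr (_ * (_ * f (_ * _))); ring.
have P15 : T (fun x y z w => (x == v x y z w)%:R * S x y z w) <= K'.
  by apply: sol_eq15 => //; apply: uB.
have P25 : T (fun x y z w => (y == v x y z w)%:R * S x y z w) <= K'.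
  rewrite sw12 (eqT _ (fun x y z w => (x == n%:R^-1 * (n2%:R * x + n1%:R * y +
     n3%:R * z + n4%:R * w))%:R * sol n2%:R n1%:R n3%:R n4%:R n%:R x y z w)).
    by apply: sol_eq15 => //; apply: uB.
  move=> x y z w; rewrite /S /sol (_ : v y x z w = n%:R^-1 * (n2%:R * x + n1%:R * y +
     n3%:R * z + n4%:R * w)); first by ring.
  by rewrite /v; congr (_ * _); ring.
have P35 : T (fun x y z w => (z == v x y z w)%:R * S x y z w) <= K'.
  rewrite sw23 sw12 (eqT _ (fun x y z w => (x == n%:R^-1 * (n3%:R * x + n1%:R * y +
     n2%:R * z + n4%:R * w))%:R * sol n3%:R n1%:R n2%:R n4%:R n%:R x y z w)).
    by apply: sol_eq15 => //; apply: uB.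
  move=> x y z w; rewrite /S /sol (_ : v y z x w = n%:R^-1 * (n3%:R * x + n1%:R * y +
     n2%:R * z + n4%:R * w)); first by ring.
  by rewrite /v; congr (_ * _); ring.
have P45 : T (fun x y z w => (w == v x y z w)%:R * S x y z w) <= K'.
  rewrite sw34 sw23 sw12 (eqT _ (fun x y z w => (x == n%:R^-1 * (n4%:R * x + n1%:R * y +
     n2%:R * z + n3%:R * w))%:R * sol n4%:R n1%:R n2%:R n3%:R n%:R x y z w)).
    by apply: sol_eq15 => //; apply: uB.
  move=> x y z w; rewrite /S /sol (_ : v y z w x = n%:R^-1 * (n4%:R * x + n1%:R * y +
     n2%:R * z + n3%:R * w)); first by ring.
  by rewrite /v; congr (_ * _); ring.
have le10 : lambda <= 10 * K'.
  apply: le_trans hl _; rewrite lS.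
  apply: (@le_trans _ _ (T (fun x y z w =>
     (x == y)%:R * S x y z w + (x == z)%:R * S x y z w +
     (x == w)%:R * S x y z w + (x == v x y z w)%:R * S x y z w +
     (y == z)%:R * S x y z w + (y == w)%:R * S x y z w +
     (y == v x y z w)%:R * S x y z w + (z == w)%:R * S x y z w +
     (z == v x y z w)%:R * S x y z w + (w == v x y z w)%:R * S x y z w))).
    by do 4![apply: le_avg => ?].
  by rewrite !TD; lra.
have : lambda * m <= 20 * D.
  rewrite -ler_pdivlMr //; apply: le_trans le10 _.
  by rewrite /K' le_eqVlt; apply/orP; left; apply/eqP; ring.
lra.
Qed.

End SidonIndicator.

(** * Sparsity of the sets of integers *)

Section UpperBound.
Variables (R : archiRealFieldType) (n1 n2 n3 n4 : nat).
Hypotheses (p1 : (0 < n1)%N) (p2 : (0 < n2)%N) (p3 : (0 < n3)%N) (p4 : (0 < n4)%N).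
Local Notation s := (n1 + n2 + n3 + n4)%N.

Lemma natr_Zp_inj N x y : (1 < N)%N -> (x < N)%N -> (y < N)%N ->
  x%:R = y%:R :> 'Z_N -> x = y.
Proof.
move=> N1 xN yN /(congr1 val) /=.
by rewrite !val_Zp_nat // !modn_small.
Qed.

Lemma sparse_Sidon (delta : R) : 0 < delta -> exists n0, forall n (A : seq nat),
  (n0 <= n)%N -> uniq A -> (forall x, x \in A -> (x <= n)%N) ->
  (forall x y z w, x \in A -> y \in A -> z \in A -> w \in A ->
    (x + y = z + w)%N -> (x = z /\ y = w) \/ (x = w /\ y = z)) ->
  (forall x y z w v, x \in A -> y \in A -> z \in A -> w \in A -> v \in A ->
    uniq [:: x; y; z; w; v] ->
    (n1 * x + n2 * y + n3 * z + n4 * w <> s * v)%N) ->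
  (size A)%:R ^+ 2 < delta * n%:R.
Proof.
move=> d0.
(* The modulus [N] below is at most [C * n], so a set with at least [delta * n] as the square of its
   size has density constant [D] in ['Z_N]. *)
pose C := (s`! * s + 1)%N.
pose D : R := Num.max 1 (C%:R / delta).
have D1 : 1 <= D by rewrite le_max lexx.
have [lambda [L0 [l0 L00 H]]] := lamc_pseudorandom n1 n2 n3 n4 D1.
(* A set with at least [Q] elements is nonempty, satisfies the strict inequality of
   [many_solutions], and has a spike of size at most [L0]. *)
pose Q : R := 20 * D / lambda + 1 + L0^-1.
have DL : 0 < 20 * D / lambda by rewrite divr_gt0 //; lra.
have Li : 0 < L0^-1 by rewrite invr_gt0.
exists (Num.bound (Q ^+ 2 / delta)).+1 => n A hn uA An sidA avA.
rewrite ltNge; apply/negP => big.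
have n0 : (0 < n)%N by apply: leq_ltn_trans hn.
have nR : 0 < n%:R :> R by rewrite ltr0n.
have Q2 : Q ^+ 2 <= (size A)%:R ^+ 2.
  apply: le_trans big; rewrite mulrC -ler_pdivrMr //; apply/ltW.
  apply: lt_le_trans (archi_boundP _) _; first by rewrite divr_ge0 ?sqr_ge0 ?ltW.
  by rewrite ler_nat ltnW.
have QA : Q <= (size A)%:R.
  by rewrite -ler_sqr ?nnegrE //; rewrite /Q; lra.
(* This modulus is coprime to every positive [k <= s], since such [k] divide [N - 1], and exceeds
   [s * n], so neither equation can wrap around. *)
pose N := (s`! * s * n).+1.
have s4 : (4 <= s)%N by move: p1 p2 p3 p4; clear; lia.
have f0 : (0 < s`!)%N := fact_gt0 s.
have Nsn : (s * n < N)%N by rewrite ltnS -mulnA leq_pmull.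
have N1 : (1 < N)%N by rewrite ltnS !muln_gt0 f0 n0 (leq_trans _ s4).
have un k : (0 < k <= s)%N -> (k%:R : 'Z_N) \is a GRing.unit.
  move=> ks; rewrite unitZpE // coprime_sym /N -addn1 /coprime.
  have /dvdnP[q ->] : (k %| s`! * s * n)%N.
    by rewrite -mulnA dvdn_mulr // dvdn_fact.
  by rewrite gcdnMDl gcdn1.
have xN x : x \in A -> (x < N)%N.
  move=> /An xn; apply: leq_ltn_trans xn _; apply: leq_ltn_trans Nsn.
  by rewrite leq_pmull // (leq_trans _ s4).
pose iota (x : nat) : 'Z_N := x%:R.
have iI : {in A &, injective iota}.
  by move=> x y xA yA; apply: natr_Zp_inj => //; apply: xN.
pose A' := [set y in map iota A].
have cA : #|A'| = size A.
  rewrite cardsE; have /card_uniqP -> : uniq (map iota A) by rewrite map_inj_in_uniq.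
  by rewrite size_map.
have sA' x : x \in A' -> exists2 y, y \in A & x = iota y.
  by rewrite inE => /mapP.
have A0 : (0 < size A)%N.
  by rewrite -(ltr0n R); apply: lt_le_trans QA; rewrite /Q; lra.
have mR : 0 < (size A)%:R :> R by rewrite ltr0n.
have sidA' x y z w : x \in A' -> y \in A' -> z \in A' -> w \in A' ->
    x + y = z + w -> (x = z /\ y = w) \/ (x = w /\ y = z).
  move=> /sA'[x' xA ->] /sA'[y' yA ->] /sA'[z' zA ->] /sA'[w' wA ->].
  rewrite /iota -!natrD => e.
  have sm a b : a \in A -> b \in A -> (a + b < N)%N.
    move=> /An an /An bn; apply: leq_ltn_trans Nsn.
    apply: leq_trans (leq_mul (leq_trans (isT : 2 <= 4)%N s4) (leqnn n)).
    by rewrite mul2n -addnn leq_add.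
  have e' : (x' + y' = z' + w')%N by apply: natr_Zp_inj e => //; apply: sm.
  by case: (sidA _ _ _ _ xA yA zA wA e') => -[-> ->]; [left|right].
have cG : #|'Z_N| = N by rewrite card_ord Zp_cast.
have cA0 : (0 < #|A'|)%N by rewrite cA.
have dense : #|'Z_N|%:R <= D * #|A'|%:R ^+ 2.
  rewrite cG cA; apply: (@le_trans _ _ (C%:R * n%:R)).
    by rewrite -natrM ler_nat /C /N mulnDl mul1n -addn1 leq_add2l.
  apply: (@le_trans _ _ (C%:R / delta * (size A)%:R ^+ 2)).
    by rewrite mulrAC ler_pdivlMr // -mulrA ler_wpM2l // [n%:R * _]mulrC.
  by rewrite ler_wpM2r ?sqr_ge0 // le_max lexx orbT.
have pr : pseudorandom D (unif R A') (#|A'|%:R)^-1.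
  split; [exact: unif_ge0|exact: avg_unifA|exact: cor_unifA|exact: cor_unifA_L2].
have us : units_of 'Z_N n1 n2 n3 n4.
  have [[b1 b2 b3 b4] _] := sum4_bounds p1 p2 p3 p4.
  by split; apply: un; apply/andP; split=> //; first [exact: ltnW b1 | exact: ltnW b2 | exact: ltnW b3 | exact: ltnW b4 | exact: leq_trans s4].
have lm : lambda <= lamc n1 n2 n3 n4 (unif R A').
  apply: H us pr _ _; first by rewrite invr_ge0.
  by rewrite cA -[leRHS]invrK lef_pV2 ?posrE //; apply: le_trans QA; rewrite /Q; lra.
have big20 : 20 * D < lambda * #|A'|%:R.
  rewrite cA [ltRHS]mulrC -ltr_pdivrMr //; apply: lt_le_trans QA; rewrite /Q; lra.
have [x [y [z [w [v [[xA yA zA wA vA] U E]]]]]] :=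
  many_solutions sidA' cA0 D1 dense p1 p2 p3 p4 un lm big20.
move: xA yA zA wA vA U E.
move=> /sA'[x' xA ->] /sA'[y' yA ->] /sA'[z' zA ->] /sA'[w' wA ->] /sA'[v' vA ->] U.
rewrite /iota -!natrM -!natrD => E.
apply: (avA _ _ _ _ _ xA yA zA wA vA).
  by move: U; rewrite -/(map iota [:: x'; y'; z'; w'; v']); apply: map_uniq.
apply: natr_Zp_inj E => //; apply: leq_ltn_trans Nsn; last by rewrite leq_mul // An.
by rewrite !mulnDl !leq_add // leq_mul // An.
Qed.

End UpperBound.

(** * A large Sidon set on a sphere *)

Section Digits.
Local Open Scope nat_scope.
Variable b : nat.

Definition enc D (f : nat -> nat) := \sum_(i < D) f i * b ^ i.

Lemma enc_recl D f : enc D.+1 f = enc D (fun i => f i.+1) * b + f 0.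
Proof.
rewrite /enc big_ord_recl expn0 muln1 addnC; congr (_ + _).
by rewrite big_distrl; apply: eq_bigr => i _; rewrite /= expnS mulnCA mulnC.
Qed.

Lemma enc_lt D f : (forall i, f i < b) -> enc D f < b ^ D.
Proof.
elim: D f => [|D IH] f fb; first by rewrite /enc big_ord0.
rewrite enc_recl expnSr.
have := IH (fun i => f i.+1) (fun i => fb i.+1); have := fb 0; move: (enc _ _) => e.
by move=> f0 eb; apply: leq_trans (leq_mul eb (leqnn b)); rewrite mulSn addnC ltn_add2r.
Qed.

Lemma enc_inj D f g : (forall i, f i < b) -> (forall i, g i < b) ->
  enc D f = enc D g -> forall i, i < D -> f i = g i.
Proof.
elim: D f g => [|D IH] f g fb gb; first by [].
rewrite !enc_recl => e.
have e0 : f 0 = g 0.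
  by have := congr1 (modn^~ b) e; rewrite !modnMDl !modn_small.
have e1 : enc D (fun i => f i.+1) = enc D (fun i => g i.+1).
  have b0 : 0 < b by apply: leq_ltn_trans (fb 0).
  by move/eqP: e; rewrite e0 eqn_add2r eqn_pmul2r // => /eqP.
by case=> [|i] //; rewrite ltnS; apply: IH e1 i => i; [apply: fb|apply: gb].
Qed.

Lemma encD D f g : enc D (fun i => f i + g i) = enc D f + enc D g.
Proof. by rewrite /enc -big_split; apply: eq_bigr => i _; rewrite mulnDl. Qed.

Lemma encZ D c f : enc D (fun i => c * f i) = c * enc D f.
Proof. by rewrite /enc big_distrr; apply: eq_bigr => i _; rewrite /= mulnA. Qed.
End Digits.

Lemma vect_coordinates (K : fieldType) (V : vectType K) :
  exists2 psi : V -> 'rV[K]_(dim V), bijective psi & {morph psi : x y / x + y}.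
Proof.
exists (VectorInternalTheory.v2r (vT := V)).
  exists (VectorInternalTheory.r2v (vT := V)).
    exact: VectorInternalTheory.v2rK.
  exact: VectorInternalTheory.r2vK.
by case: (v2r_semilinear (VectorInternalTheory.v2r_subproof V)) => _ h x y; apply: h.
Qed.

(** The field of order [p ^ d] is a vector space over ['F_p]; comparing cardinalities shows that its
    dimension is [d]. *)
Lemma field_coordinates p d : prime p -> (0 < d)%N ->
  exists (F : finFieldType) (phi : F -> 'I_d -> 'F_p),
  [/\ p \in [pchar F], #|F| = (p ^ d)%N,
      forall x y i, phi (x + y) i = phi x i + phi y i &
      forall x y, phi x =1 phi y -> x = y].
Proof.
move=> pp d0; have [F charF cardF] := pPrimePowerField pp d0.
have [psi psiB psiD] := @vect_coordinates 'F_p (pPrimeCharType charF).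
have dimL : dim (pPrimeCharType charF) = d.
  have cL : (p ^ d)%N = #|'rV['F_p]_(dim (pPrimeCharType charF))|.
    by rewrite -cardF; apply: bij_eq_card psiB.
  apply/eqP; rewrite -(eqn_exp2l _ _ (prime_gt1 pp)) cL.
  by rewrite card_mx mul1n card_Fp.
exists F, (fun x i => psi x 0 (cast_ord (esym dimL) i)); split=> //.
  by move=> x y i; rewrite psiD mxE.
move=> x y e; apply: (bij_inj psiB); apply/rowP => i.
by have := e (cast_ord dimL i); rewrite cast_ordK.
Qed.

(* Strict convexity of the sphere: [s] times a point of the sphere is a positive
   combination of points of the same sphere only when these all coincide. *)
Lemma sphere_convex D (n1 n2 n3 n4 : nat) (x y z w v : nat -> nat) r :
  let s := (n1 + n2 + n3 + n4)%N in
  let sq u := (\sum_(i < D) u i ^ 2)%N in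
  (0 < n1)%N -> sq x = r -> sq y = r -> sq z = r -> sq w = r -> sq v = r ->
  (forall i, (i < D)%N -> n1 * x i + n2 * y i + n3 * z i + n4 * w i = s * v i)%N ->
  forall i, (i < D)%N -> x i = v i.
Proof.
move=> s sq n10 hx hy hz hw hv e.
pose S (u : nat -> nat) : int := \sum_(i < D) (u i)%:Z ^+ 2.
have SE u : S u = (sq u)%:Z.
  rewrite /S /sq (big_morph Posz PoszD (erefl : Posz 0 = 0)).
  by apply: eq_bigr => i _; rewrite -mulnn PoszM expr2.
pose q (a : nat) (u : nat -> nat) i : int := a%:Z * ((u i)%:Z - (v i)%:Z) ^+ 2.
have q0 a u i : 0 <= q a u i by rewrite mulr_ge0 // sqr_ge0.
(* The linear relation evaluates the cross terms of the expanded squares, and what remains cancels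
   because all the points have the same norm. *)
have tot : \sum_(i < D) (q n1 x i + q n2 y i + q n3 z i + q n4 w i) = 0.
  transitivity (n1%:Z * S x + n2%:Z * S y + n3%:Z * S z + n4%:Z * S w - s%:Z * S v).
    rewrite /S !mulr_sumr -!big_split -sumrB; apply: eq_bigr => i _.
    have := congr1 Posz (e i (ltn_ord i)).
    rewrite /q /s !PoszD !PoszM.
    move: (x i)%:Z (y i)%:Z (z i)%:Z (w i)%:Z (v i)%:Z => X Y Z W V E /=.
    apply/eqP; rewrite -subr_eq0; apply/eqP.
    transitivity (-2 * V * (n1%:Z * X + n2%:Z * Y + n3%:Z * Z + n4%:Z * W -
       (n1%:Z + n2%:Z + n3%:Z + n4%:Z) * V)); first by ring.
    by rewrite E subrr mulr0.
  rewrite !SE hx hy hz hw hv /s !PoszD; ring.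
move=> i iD.
have : q n1 x i + q n2 y i + q n3 z i + q n4 w i = 0.
  by apply: (psumr_eq0P _ tot (i := Ordinal iD)) => // j _; rewrite !addr_ge0 ?q0.
move/eqP; rewrite !paddr_eq0 ?addr_ge0 //; case/andP=> /andP[/andP[h _] _] _.
by move: h; rewrite mulf_eq0 sqrf_eq0 subr_eq0 => /orP[|/eqP[]//]; lia.
Qed.

(** Eliminating [y] turns the second equation into [2 (x - z) (x - w) = 0]. *)
Lemma sidon_parabola (F : fieldType) (x y z w : F) : 2%:R != 0 :> F ->
  x + y = z + w -> x ^+ 2 + y ^+ 2 = z ^+ 2 + w ^+ 2 ->
  (x = z /\ y = w) \/ (x = w /\ y = z).
Proof.
move=> c2 e1 e2.
have ey : y = z + w - x by rewrite -e1 addrC addKr.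
have : 2%:R * ((x - z) * (x - w)) = 0.
  transitivity (x ^+ 2 + (z + w - x) ^+ 2 - (z ^+ 2 + w ^+ 2)); first by ring.
  by rewrite -ey e2 subrr.
move/eqP; rewrite !mulf_eq0 (negPf c2) /= !subr_eq0 => /orP[] /eqP xz; [left|right].
  by split=> //; apply: (addrI x); rewrite e1 xz.
by split=> //; apply: (addrI x); rewrite e1 xz addrC.
Qed.

Lemma large_fiber (T : finType) (f : T -> nat) m : (forall x, (f x < m)%N) ->
  exists r, (#|T| <= m * #|[set x | f x == r]|)%N.
Proof.
move=> fm; have [-> | T0] := posnP #|T|; first by exists 0%N.
have m0 : (0 < m)%N by case/card_gt0P: T0 => x _; apply: leq_ltn_trans (fm x).
case: (pickP (fun r : 'I_m => #|T| <= m * #|[set x | f x == r]|)%N).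
  by move=> r hr; exists (r : nat).
move=> no; have E : (\sum_(r < m) #|[set x | f x == r]| = #|T|)%N.
  rewrite -[RHS]sum1_card (partition_big (fun x => Ordinal (fm x)) predT) //=.
  by apply: eq_bigr => r _; rewrite -sum1dep_card.
have : (\sum_(r < m) (m * #|[set x | f x == r]| + 1) <= \sum_(r < m) #|T|)%N.
  by apply: leq_sum => r _; rewrite addn1 ltnNge (no r).
rewrite big_split /= -big_distrr /= E !sum_nat_const card_ord muln1.
by rewrite -[leqRHS]addn0 leq_add2l leqNgt m0.
Qed.

(** The digits of an element are the coordinates of [x] followed by those of [x ^+ 2]. In base
    [s * p] neither equation produces carries, so both hold digit by digit, and the Sidon equation
    read modulo [p] becomes that of the parabola. The sphere condition concerns only the first [d]
    digits, which already determine [x]. *)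
Lemma Behrend_Sidon p d n1 n2 n3 n4 (s := (n1 + n2 + n3 + n4)%N) :
  prime p -> odd p -> (0 < d)%N ->
  (0 < n1)%N -> (0 < n2)%N -> (0 < n3)%N -> (0 < n4)%N ->
  exists A : seq nat, [/\ uniq A, forall x, x \in A -> (0 < x <= (s * p) ^ (d + d))%N,
    forall x y z w, x \in A -> y \in A -> z \in A -> w \in A ->
      (x + y = z + w)%N -> (x = z /\ y = w) \/ (x = w /\ y = z),
    forall x y z w v, x \in A -> y \in A -> z \in A -> w \in A -> v \in A ->
      uniq [:: x; y; z; w; v] ->
      (n1 * x + n2 * y + n3 * z + n4 * w <> s * v)%N &
    (p ^ d <= (d * p ^ 2).+1 * size A)%N].
Proof.
move=> pp op d0 p1 p2 p3 p4.
have [F [phi [charF cardF phiD phiI]]] := field_coordinates pp d0.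
have p0 := prime_gt0 pp; have p_gt1 := prime_gt1 pp.
have s4 : (4 <= s)%N by rewrite /s; move: p1 p2 p3 p4; clear; lia.
pose del (x : F) i : nat := if insub i is Some j then phi x j : nat else 0.
have delE x (j : 'I_d) : del x j = phi x j by rewrite /del valK.
have del_lt x i : (del x i < p)%N.
  rewrite /del; case: insub => [j|] //.
  by have := ltn_ord (phi x j); rewrite [X in (_ < X)%N]Fp_cast.
pose dg x i := if (i < d)%N then del x i else del (x ^+ 2) (i - d)%N.
have dg_lt x i : (dg x i < p)%N by rewrite /dg; case: ifP.
(* The successor makes the elements positive; it cancels in both equations, whose two sides have
   equal total weight. *)
pose e x := (enc (s * p) (d + d) (dg x)).+1.
have lin x y : (forall i, (i < d)%N -> del x i = del y i) -> x = y.
  by move=> h; apply: phiI => j; apply: val_inj; rewrite /= -!delE h.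
have add2 x y z w : (forall i, (i < d)%N -> del x i + del y i = del z i + del w i)%N ->
    x + y = z + w.
  move=> h; apply: phiI => j; rewrite !phiD.
  have := congr1 (fun k => k%:R : 'F_p) (h j (ltn_ord j)).
  by rewrite !delE !natrD !natr_Zp.
have dg2 x y z w : (e x + e y = e z + e w)%N ->
    forall i, (i < d + d)%N -> (dg x i + dg y i = dg z i + dg w i)%N.
  rewrite /e !addSn !addnS => -[] E; apply: (@enc_inj (s * p)); last by rewrite !encD.
    move=> i; apply: leq_trans (leq_mul (leq_trans (isT : 2 <= 4)%N s4) (leqnn p)).
    by rewrite mul2n -addnn -addSn leq_add // ltnW.
  move=> i; apply: leq_trans (leq_mul (leq_trans (isT : 2 <= 4)%N s4) (leqnn p)).
  by rewrite mul2n -addnn -addSn leq_add // ltnW.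
have c2 : 2%:R != 0 :> F.
  rewrite -(dvdn_pcharf charF) gtnNdvd //.
  by case: (p) pp op => [|[|[|[]]]].
have eS x y z w : (e x + e y = e z + e w)%N -> (x = z /\ y = w) \/ (x = w /\ y = z).
  move=> /dg2 h; apply: sidon_parabola => //; apply: add2 => i id.
    by have := h i (ltn_addr _ id); rewrite /dg id.
  have nd : (d + i < d)%N = false by rewrite ltnNge leq_addr.
  by have := h (d + i)%N; rewrite ltn_add2l /dg nd addKn; apply.
have eI : injective e.
  by move=> x y exy; have [|[]|[]] := eS x x y y; rewrite ?exy.
pose sq x := (\sum_(i < d) del x i ^ 2)%N.
(* There are at most [d * p ^ 2 + 1] squared radii, so some sphere receives its share of the
   field. *)
have sq_lt x : (sq x < (d * p ^ 2).+1)%N.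
  rewrite ltnS -[X in (X * _)%N]card_ord -sum_nat_const leq_sum // => i _.
  by rewrite leq_exp2r // ltnW.
have [r hr] := large_fiber sq_lt.
pose A := [seq e x | x <- enum [set x | sq x == r]].
have inA a : a \in A -> exists2 x, sq x = r & a = e x.
  by case/mapP => x; rewrite mem_enum inE => /eqP hx ->; exists x.
exists A; split.
- by rewrite map_inj_uniq ?enum_uniq.
- move=> _ /inA[x _ ->]; rewrite /e /= enc_lt // => i.
  by apply: leq_trans (dg_lt x i) _; rewrite leq_pmull // (leq_trans _ s4).
- move=> _ _ _ _ /inA[x _ ->] /inA[y _ ->] /inA[z _ ->] /inA[w _ ->] /eS.
  by case=> -[-> ->]; [left|right].
- move=> _ _ _ _ _ /inA[x hx ->] /inA[y hy ->] /inA[z hz ->] /inA[w hw ->]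
    /inA[v hv ->] U E.
  suff xv : x = v by move: U; rewrite xv /= !inE eqxx !orbT.
  apply: lin; apply: (sphere_convex p1 hx hy hz hw hv) => i id.
  have E' : enc (s * p) (d + d) (fun i => n1 * dg x i + n2 * dg y i + n3 * dg z i +
      n4 * dg w i)%N = enc (s * p) (d + d) (fun i => s * dg v i)%N.
    by rewrite !encD !encZ; move: E; rewrite /e /s; clear; lia.
  have := @enc_inj (s * p) _ _ _ _ _ E' i (ltn_addr _ id).
  rewrite /dg id; apply=> j.
    have le c (k : nat) x' : (c * dg x' k <= c * p)%N by rewrite leq_mul2l ltnW ?orbT.
    have lt1 : ((n1 * dg x j).+1 <= n1 * p)%N by rewrite ltn_pmul2l.
    have := leq_add (leq_add (leq_add lt1 (le n2 j y)) (le n3 j z)) (le n4 j w).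
    by rewrite /s !mulnDl !addSn.
  have s0 : (0 < s)%N by apply: leq_trans s4.
  by rewrite (ltn_pmul2l s0) dg_lt.
- by rewrite size_map -cardE -cardF.
Qed.

(** * Translation to lists of integers and real analysis *)

Lemma InP (T : eqType) (x : T) A : reflect (List.In x A) (x \in A).
Proof.
elim: A => [|y A IH] /=; first by constructor.
rewrite inE; apply: (iffP orP) => [[/eqP->|/IH]|[->|/IH]]; by [left|right].
Qed.

Lemma NoDupP (T : eqType) (A : seq T) : reflect (List.NoDup A) (uniq A).
Proof.
elim: A => [|y A IH] /=; first by do 2!constructor.
apply: (iffP andP) => [[/InP yA /IH uA]|uA]; first by constructor.
by inversion uA; split; [apply/InP|apply/IH].
Qed.

Section Bridge.
Variables a1 a2 a3 a4 : nat.
Hypotheses (q1 : (0 < a1)%coq_nat) (q2 : (0 < a2)%coq_nat).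
Hypotheses (q3 : (0 < a3)%coq_nat) (q4 : (0 < a4)%coq_nat).
Let p1 : (0 < a1)%N. Proof. exact/ssrnat.ltP. Qed.
Let p2 : (0 < a2)%N. Proof. exact/ssrnat.ltP. Qed.
Let p3 : (0 < a3)%N. Proof. exact/ssrnat.ltP. Qed.
Let p4 : (0 < a4)%N. Proof. exact/ssrnat.ltP. Qed.

Lemma admissible_sparse (delta : Rdefinitions.R) : Rlt R0 delta ->
  exists n0, forall n A, (n0 <= n)%coq_nat -> admissible a1 a2 a3 a4 n A ->
    Rlt (Rmult (INR (length A)) (INR (length A))) (Rmult delta (INR n)).
Proof.
move=> /RltP d0; have [n0 H] := sparse_Sidon p1 p2 p3 p4 d0.
exists n0 => n A /ssrnat.leP hn [uA [bA [sA aA]]].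
apply/RltP; rewrite !RmultE !INRE -expr2; apply: (H n A hn).
- exact/NoDupP.
- by move=> x /InP /bA [_ /ssrnat.leP].
- by move=> x y z w /InP xA /InP yA /InP zA /InP wA; apply: sA.
- move=> x y z w v /InP xA /InP yA /InP zA /InP wA /InP vA U.
  by apply: aA => //; apply/NoDupP.
Qed.

Lemma pow_expn m n : Nat.pow m n = (m ^ n)%N.
Proof. by elim: n => [|n IH] //=; rewrite IH expnS. Qed.

Lemma admissible_large m : exists p, (m <= p)%coq_nat /\
  forall n d, (1 <= d)%coq_nat ->
    (Nat.pow (Nat.mul (Nat.add (Nat.add (Nat.add a1 a2) a3) a4) p) (Nat.mul 2 d)
       <= n)%coq_nat ->
    exists A, admissible a1 a2 a3 a4 n A /\
      (Nat.pow p d <= Nat.mul (S (Nat.mul d (Nat.mul p p))) (length A))%coq_nat.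
Proof.
have [p pm pp] := prime_above (maxn m 2).
have op : odd p by case: (even_prime pp) pm => // ->; rewrite gtn_max ltnn andbF.
exists p; split; first by apply/ssrnat.leP; apply: ltnW; apply: leq_ltn_trans pm; rewrite leq_maxl.
move=> n d /ssrnat.leP d0; rewrite pow_expn => /ssrnat.leP hn.
have [A [uA bA sA eA cA]] := Behrend_Sidon pp op d0 p1 p2 p3 p4.
exists A; split; last first.
  by apply/ssrnat.leP; rewrite pow_expn; move: cA; rewrite -mulnn.
split; [exact/NoDupP|split; [|split]].
- move=> x /InP /bA /andP[x0 xn]; split; apply/ssrnat.leP => //.
  by apply: leq_trans xn _; rewrite addnn -mul2n.
- by move=> x y z w /InP xA /InP yA /InP zA /InP wA; apply: sA.
- move=> x y z w v /InP xA /InP yA /InP zA /InP wA /InP vA /NoDupP U.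
  exact: eA.
Qed.
End Bridge.
End Combinatorics.

(** * Asymptotics of the two bounds *)

Lemma log_bracket (b n : nat) : (2 <= b)%nat -> (1 <= n)%nat ->
  exists d, (b ^ (2 * d) <= n < b ^ (2 * S d))%nat.
Proof.
intros hb hn.
assert (H : forall k, (n < b ^ (2 * k))%nat ->
  exists d, (b ^ (2 * d) <= n < b ^ (2 * S d))%nat).
{ induction k as [|k IH]; intros hk.
  - simpl in hk. lia.
  - destruct (le_lt_dec (b ^ (2 * k)) n) as [h|h]; [exists k; auto | auto]. }
apply (H n), Nat.lt_le_trans with (b ^ n)%nat.
- apply Nat.pow_gt_lin_r. lia.
- apply Nat.pow_le_mono_r; lia.
Qed.

(** [exp x] is the square of [exp (x / 2) >= 1 + x / 2], hence grows at least quadratically, while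
    [C] is at most [x / 8]. *)
Lemma exp_beats_linear (C x : R) : 1 <= x -> 8 * C <= x -> 0 <= C ->
  C * (x + 1) <= exp x.
Proof.
intros h1 h2 h3.
replace x with (x / 2 + x / 2) at 2 by lra. rewrite exp_plus.
assert (h := exp_ineq1_le (x / 2)).
nra.
Qed.

Theorem theorem1p15 (a1 a2 a3 a4 : nat) (S : nat -> nat) :
  (0 < a1)%nat -> (0 < a2)%nat -> (0 < a3)%nat -> (0 < a4)%nat ->
  (forall n, is_max_size a1 a2 a3 a4 n (S n)) ->
  is_lim_seq (fun n => INR (S n) / sqrt (INR n)) 0 /\
  (forall eps : R, 0 < eps ->
     exists N : nat, forall n : nat, (N <= n)%nat ->
       Rpower (INR n) (/2 - eps) <= INR (S n)).
Proof.
intros p1 p2 p3 p4 hS. split.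
- apply is_lim_seq_spec. intros eps. simpl.
  assert (e0 := cond_pos eps).
  destruct (Combinatorics.admissible_sparse p1 p2 p3 p4) with (delta := eps * eps)
    as [n0 H].
  { nra. }
  exists (Nat.max n0 1). intros n hn.
  destruct (hS n) as [[A [hA <-]] _].
  assert (hn0 : 0 < INR n) by (apply lt_0_INR; lia).
  assert (h : INR (length A) * INR (length A) < eps * eps * INR n)
    by (apply H; [lia | exact hA]).
  assert (q0 := sqrt_lt_R0 _ hn0).
  assert (qq := sqrt_sqrt _ (Rlt_le _ _ hn0)).
  assert (l0 := pos_INR (length A)).
  rewrite Rminus_0_r, Rabs_pos_eq by (apply Rdiv_le_0_compat; assumption).
  apply Rlt_div_l; [assumption|].
  apply Rsqr_incrst_0; [|assumption | nra].
  unfold Rsqr. rewrite <- qq in h. lra.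
(* The cap at 1/4 keeps the exponent [/2 - e] positive, so that the power increases with [n]; a
   smaller [e] only strengthens the bound. *)
- intros eps0 he0. pose (e := Rmin eps0 (/ 4)).
  assert (he : 0 < e <= / 4).
  { unfold e. split; [apply Rmin_pos; lra | apply Rmin_r]. }
  pose (s := (a1 + a2 + a3 + a4)%nat).
  assert (s4 : 4 <= INR s) by (change 4 with (IZR (Z.of_nat 4)); rewrite <- INR_IZR_INZ;
    apply le_INR; unfold s; lia).
  assert (ls : 1 < ln (INR s)).
  { rewrite <- (ln_exp 1) at 1. apply ln_increasing; [apply exp_pos|].
    assert (h := exp_le_3). lra. }
  (* A prime [p] above [exp (ln s / e)] satisfies [s <= p ^ e], which makes the factor [s] in the
     base affordable. *)
  destruct (nfloor_ex (exp (ln (INR s) / e))) as [m0 hm0].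
  { left. apply exp_pos. }
  destruct (Combinatorics.admissible_large p1 p2 p3 p4) with (m := Nat.max (m0 + 1) 2)
    as [p [pm H]].
  fold s in H.
  assert (p2' : 2 <= INR p) by (change 2 with (INR 2); apply le_INR; lia).
  assert (lp : ln (INR s) <= e * ln (INR p)).
  { assert (h : ln (INR s) / e <= ln (INR p)).
    { rewrite <- (ln_exp (ln (INR s) / e)). left. apply ln_increasing; [apply exp_pos|].
      apply Rlt_le_trans with (INR (m0 + 1)).
      - rewrite plus_INR. simpl. lra.
      - apply le_INR. lia. }
    apply (Rmult_le_compat_l e) in h; [|lra].
    replace (e * (ln (INR s) / e)) with (ln (INR s)) in h by (field; lra).
    exact h. }
  pose (b := (s * p)%nat).
  assert (b2 : (2 <= b)%nat) by (unfold b, s; nia).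
  pose (C := INR (p * p) * INR b).
  (* For [d >= d0] the constant [C] is at most [d / 8], as [exp_beats_linear] requires. *)
  pose (d0 := (8 * (p * p * b))%nat).
  exists (b ^ (2 * d0))%nat. intros n hn.
  assert (b0 : (1 <= b ^ (2 * d0))%nat) by (apply Nat.neq_0_lt_0, Nat.pow_nonzero; lia).
  destruct (log_bracket b n) as [d [hd1 hd2]]; [lia | lia |].
  assert (dd : (d0 <= d)%nat).
  { destruct (le_lt_dec d0 d) as [h|h]; [exact h|exfalso].
    assert (h' : (b ^ (2 * Datatypes.S d) <= b ^ (2 * d0))%nat)
      by (apply Nat.pow_le_mono_r; lia).
    lia. }
  assert (pp1 : (1 <= p * p * b)%nat) by (unfold b, s; nia).
  assert (d1 : (1 <= d)%nat) by (unfold d0 in dd; lia).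
  destruct (H n d d1 hd1) as [A [hA cA]].
  apply Rle_trans with (INR (length A)); [|apply le_INR, (proj2 (hS n)); exact hA].
  assert (n1 : 1 <= INR n) by (change 1 with (INR 1); apply le_INR; lia).
  apply Rle_trans with (Rpower (INR n) (/ 2 - e)).
  { destruct (Rle_lt_or_eq_dec 1 (INR n) n1) as [h|h].
    - apply Rle_Rpower; [lra|]. unfold e. assert (h' := Rmin_l eps0 (/ 4)). lra.
    - rewrite <- h. unfold Rpower. rewrite ln_1, !Rmult_0_r. lra. }
  set (L := ln (INR s) + ln (INR p)).
  assert (lb : ln (INR b) = L) by (unfold b, L; rewrite mult_INR, ln_mult; lra).
  assert (X : ln (INR n) <= 2 * (INR d + 1) * L).
  { rewrite <- lb.
    replace (2 * (INR d + 1)) with (INR (2 * Datatypes.S d))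
      by (rewrite mult_INR, (S_INR d); simpl; lra).
    rewrite <- ln_pow by (apply lt_0_INR; lia). rewrite <- pow_INR.
    left. apply ln_increasing; [lra|]. apply lt_INR. exact hd2. }
  assert (dR : 1 <= INR d) by (change 1 with (INR 1); apply le_INR; lia).
  (* [exp d] absorbs the pigeonhole loss and one factor [b]; the latter covers the gap between [n]
     and [b ^ (2 * d)]. *)
  assert (big : INR (Datatypes.S (d * (p * p))) * INR b <= exp (INR d)).
  { apply Rle_trans with (C * (INR d + 1)).
    - rewrite S_INR, mult_INR. unfold C.
      assert (h1 : 1 <= INR (p * p)) by (change 1 with (INR 1); apply le_INR; nia).
      assert (h2 := pos_INR b). nra.
    - apply exp_beats_linear; [exact dR| |].
      + unfold C. rewrite <- mult_INR. replace 8 with (INR 8) by (simpl; lra).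
        rewrite <- mult_INR. apply le_INR. exact dd.
      + unfold C. rewrite <- mult_INR. apply pos_INR. }
  assert (bE : INR b = exp L) by (rewrite <- lb, exp_ln; [reflexivity | apply lt_0_INR; lia]).
  apply le_INR in cA. rewrite mult_INR in cA.
  set (Q := INR (Datatypes.S (d * (p * p)))) in *.
  assert (Q0 : 0 < Q) by (apply lt_0_INR; lia).
  apply Rmult_le_reg_l with Q; [exact Q0|].
  apply Rle_trans with (INR (p ^ d)); [|exact cA].
  apply Rle_trans with (exp (INR d - L) * exp ((/ 2 - e) * ln (INR n))).
  { apply Rmult_le_compat_r; [left; apply exp_pos|].
    unfold Rminus. rewrite exp_plus, exp_Ropp.
    apply Rmult_le_reg_r with (exp L); [apply exp_pos|].
    rewrite Rmult_assoc, Rinv_l, Rmult_1_r by (apply Rgt_not_eq, exp_pos).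
    rewrite <- bE. exact big. }
  rewrite <- exp_plus, pow_INR.
  rewrite <- (exp_ln (INR p ^ d)) by (apply pow_lt; lra).
  rewrite ln_pow by lra.
  assert (mon : forall u v, u <= v -> exp u <= exp v).
  { intros u v [h|h]; [left; apply exp_increasing; exact h | rewrite h; lra]. }
  apply mon.
  assert (X' : (/ 2 - e) * ln (INR n) <= (/ 2 - e) * (2 * (INR d + 1) * L))
    by (apply Rmult_le_compat_l; lra).
  assert (L0 : 0 <= e * L) by (unfold L; nra).
  (* Since [e * ln p >= ln s], the saving [2 * e * ln p] is at least [2 * ln s]; it pays for the
     term [ln s] of [L] and for the summand 1, as [ln s > 1]. *)
  assert (k : 1 + (1 - 2 * e) * L <= ln (INR p)) by (unfold L; nra).
  apply (Rmult_le_compat_l (INR d)) in k; lra.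
Qed.
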